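(* Let $d\ge1$ and let $S$ be a non-empty subset of $\{1,\dots,d\}$. (i) The family of linear maps $\{\widetilde\rho_{S,n}\}_{n\ge1}$, viewed on $\{k_SY_{d,n}\}_{n\ge1}$, satisfies (M1) $\widetilde\rho_{S,n}(xy)=\widetilde\rho_{S,n}(yx)$ for any $n\ge1$ and $x,y\in k_SY_{d,n}$, and (M2) $\widetilde\rho_{S,n+1}(xg_n)=\widetilde\rho_{S,n+1}(xg_n^{-1})=\widetilde\rho_{S,n}(x)$ for any $n\ge1$ and $x\in k_SY_{d,n}$, and is thus a Markov trace on $\{k_SY_{d,n}\}_{n\ge1}$. (ii) Moreover, $\mathrm F\Delta_{Y,S}=\mathrm F\Gamma^{\sqrt q^{-1}}_{Y,\tilde\rho_S}$.
   Context: Let $\xi_1,\dots,\xi_d$ be the $d$-th roots of unity in $\mathbb C$, $q,z$ indeterminates, $k=\mathbb C(\sqrt q,z)$. Write $s_i=(i,i+1)$. Algebra $\widetilde Y_{d,n}$: unital algebra over $\mathbb C[q,q^{-1}]$ with generators $G_1,\dots,G_{n-1},t_1,\dots,t_n$ and relations $G_iG_j=G_jG_i$ ($|i-j|>1$), $G_iG_{i+1}G_i=G_{i+1}G_iG_{i+1}$, $t_it_j=t_jt_i$, $G_it_j=t_{s_i(j)}G_i$, $t_j^d=1$, $G_i^2=1+(q-1)e_i+(q-1)e_iG_i$, where $e_i=\frac1d\sum_{s=0}^{d-1}t_i^st_{i+1}^{-s}$; $\widetilde Y_{d,n}\subset\widetilde Y_{d,n+1}$ naturally. For a non-empty $S\subset\{1,\dots,d\}$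 set $c_b=\frac1{|S|}\sum_{a\in S}\xi_a^b$ for $b=0,\dots,d-1$, and let $\operatorname{tr}_S$ be the unique (by a theorem of Juyumaya) $k$-linear function on the chain of algebras $k\widetilde Y_{d,n}$ with values in $k$ satisfying: $\operatorname{tr}_S(1)=1$; $\operatorname{tr}_S(xy)=\operatorname{tr}_S(yx)$ for $x,y\in\widetilde Y_{d,n}$, $n\ge1$; $\operatorname{tr}_S(xG_n)=z\operatorname{tr}_S(x)$ for $x\in\widetilde Y_{d,n}$, $n\ge1$; $\operatorname{tr}_S(xt_{n+1}^b)=c_b\operatorname{tr}_S(x)$ for $x\in\widetilde Y_{d,n}$, $n\ge0$, $0\le b\le d-1$. Set $$E_S=\frac1{|S|},\quad\lambda_S=\frac{z+(1-q)E_S}{qz},\quad D_S=\frac1{\sqrt{\lambda_S}\,z},$$ and let $k_S$ be the field $k$ extended by an element $\sqrt{\lambda_S}$. Define $\widetilde\rho_{S,n}:k_S\widetilde Y_{d,n}\to k_S$ by $\widetilde\rho_{S,n}(x)=D_S^{n-1}\operatorname{tr}_S(x)$. Algebra $k_SY_{d,n}$: unital $k_S$-algebra with generators $g_1,\dots,g_{n-1},t_1,\dots,t_n$ and relations $g_ig_j=g_jg_i$ ($|i-j|>1$), $g_ig_{i+1}g_i=g_{i+1}g_ig_{i+1}$, $t_it_j=t_jt_i$, $g_it_j=t_{s_i(j)}g_i$, $t_j^d=1$, $g_i^2=u^2+v\,e_ig_i$, with $u=\sqrt q\sqrt{\lambda_S}$ and $v=(q-1)\sqrt{\lambda_S}$.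 It is identified with $k_S\widetilde Y_{d,n}$ via $g_i=\sqrt{\lambda_S}\bigl(\sqrt q+(1-\sqrt q)e_i\bigr)G_i$, $t_j=t_j$ (an isomorphism with inverse $G_i=\sqrt{\lambda_S}^{-1}(\sqrt q^{-1}+(1-\sqrt q^{-1})e_i)g_i$); via this identification $\widetilde\rho_{S,n}$ is a linear map on $k_SY_{d,n}$. Framed braids and links: $\mathbb Z/d\mathbb Z\wr B_n$ is the group generated by $\sigma_1,\dots,\sigma_{n-1},t_1,\dots,t_n$ with the braid relations for the $\sigma_i$ and $t_it_j=t_jt_i$, $\sigma_it_j=t_{s_i(j)}\sigma_i$, $t_j^d=1$. A $\mathbb Z/d\mathbb Z$-framed link is an (oriented) link each of whose components carries an element of $\mathbb Z/d\mathbb Z$; every such $\tilde K$ is the closure of some $\tilde\beta_{\tilde K}\in\mathbb Z/d\mathbb Z\wr B_n$ for some $n$ (framings of strands forming a component are added). Juyumaya--Lambropoulou invariants: with $\widetilde\delta^{(S)}_{Y,n}:k_S[\mathbb Z/d\mathbb Z\wr B_n]\to k_S\widetilde Y_{d,n}$ the algebra morphism $\sigma_i\mapsto\sqrt{\lambda_S}G_i$, $t_j\mapsto t_j$, one sets $\mathrm F\Delta_{Y,S}(\tilde K)=D_S^{n-1}\operatorname{tr}_S\circ\widetilde\delta^{(S)}_{Y,n}(\tilde\beta_{\tilde K})$ (known to be an isotopy invariant of $\mathbb Z/d\mathbb Z$-framed links). Invariants $\mathrm F\Gamma$: for $\gamma\in k_S\setminus\{0\}$, $\delta^\gamma_{Y,n}:k_S[\mathbb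 Z/d\mathbb Z\wr B_n]\to k_SY_{d,n}$ is the algebra morphism $\sigma_i\mapsto(\gamma+(1-\gamma)e_i)g_i$, $t_j\mapsto t_j$, and for a Markov trace $\rho=\{\rho_n\}$ on $\{k_SY_{d,n}\}_{n\ge1}$ (a family of $k_S$-linear maps $k_SY_{d,n}\to k_S$ satisfying (M1),(M2)), $\mathrm F\Gamma^\gamma_{Y,\rho}(\tilde K)=\rho_n\circ\delta^\gamma_{Y,n}(\tilde\beta_{\tilde K})$. *)

(* Defs.v *)
From HB Require Import structures.
From mathcomp Require Import all_boot all_order all_fingroup all_algebra all_field.
From mathcomp Require Import boolp classical_sets reals complex.
From mathcomp Require Import generic_quotient ring_quotient.
From mathcomp.multinomials Require Import monalg.
Set Implicit Arguments. Unset Strict Implicit. Unset Printing Implicit Defensive.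
Import Order.TTheory GRing.Theory Num.Theory.
Local Open Scope ring_scope.
Local Open Scope quotient_scope.

(* The two-sided ideal generated by the differences l - r of related elements. *)
Inductive rel_ideal (K : fieldType) (A : algType K) (rel : A -> A -> Prop) :
    A -> Prop :=
| rel_ideal_gen l r a b : rel l r -> rel_ideal rel (a * (l - r) * b)
| rel_ideal_zero : rel_ideal rel 0
| rel_ideal_add x y :
    rel_ideal rel x -> rel_ideal rel y -> rel_ideal rel (x + y).

(* [rel_proper] makes the quotient a nonzero algebra, as [algType] requires. *)
Record relations (K : fieldType) (A : algType K) := Relations {
  relator :> A -> A -> Prop;
  rel_proper : ~ rel_ideal relator 1
}.

Section QuotientAlgebra.
Context (K : fieldType) (A : algType K) (P : relations A).

Local Notation I := (rel_ideal P).

Definition rel_ideal_pred : {pred A} := fun x => `[< I x >].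

Lemma rel_idealMl a x : I x -> I (a * x).
Proof.
elim=> [l r b c lr||y z _ IHy _ IHz].
- by rewrite !mulrA; exact: rel_ideal_gen.
- by rewrite mulr0; exact: rel_ideal_zero.
- by rewrite mulrDr; exact: rel_ideal_add.
Qed.

Lemma rel_idealMr a x : I x -> I (x * a).
Proof.
elim=> [l r b c lr||y z _ IHy _ IHz].
- by rewrite -mulrA; exact: rel_ideal_gen.
- by rewrite mul0r; exact: rel_ideal_zero.
- by rewrite mulrDl; exact: rel_ideal_add.
Qed.

Fact rel_ideal_zmod_closed : zmod_closed rel_ideal_pred.
Proof.
split=> [|x y /asboolP Ix /asboolP Iy]; apply/asboolP.
  exact: rel_ideal_zero.
by rewrite -mulN1r; apply/rel_ideal_add/rel_idealMl.
Qed.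

HB.instance Definition _ := GRing.isZmodClosed.Build A rel_ideal_pred
  rel_ideal_zmod_closed.

Definition quot_alg : Type := {ideal_quot rel_ideal_pred}.
HB.instance Definition _ := GRing.Zmodule.on quot_alg.
HB.instance Definition _ := EqQuotient.on quot_alg.

Definition qclass (x : A) : quot_alg := \pi x.

Lemma qclassP x y : qclass x = qclass y <-> I (x - y).
Proof.
rewrite /qclass; split=> [/eqP|Ixy].
  by rewrite -(Quotient.idealrBE rel_ideal_pred) => /asboolP.
by apply/eqP; rewrite -(Quotient.idealrBE rel_ideal_pred); apply/asboolP.
Qed.

Lemma qclassK u : qclass (repr u) = u. Proof. exact: reprK. Qed.

Lemma qclassD : {morph qclass : x y / x + y}. Proof. exact: raddfD. Qed.

Let qmul (u v : quot_alg) := qclass (repr u * repr v).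
Let qscale (c : K) (u : quot_alg) := qclass (c *: repr u).

Let qmulE x y : qclass (x * y) = qmul (qclass x) (qclass y).
Proof.
apply/qclassP.
set x' := repr _; set y' := repr _.
have -> : x * y - x' * y' = (x - x') * y + x' * (y - y').
  by rewrite mulrBl mulrBr addrA subrK.
by apply: rel_ideal_add; [apply: rel_idealMr|apply: rel_idealMl];
  apply/qclassP; rewrite qclassK.
Qed.

Let qscaleE c x : qclass (c *: x) = qscale c (qclass x).
Proof.
apply/qclassP; rewrite -scalerBr -mulr_algl; apply: rel_idealMl.
by apply/qclassP; rewrite qclassK.
Qed.

Let qmulA : associative qmul.
Proof.
move=> u v w; rewrite -[u]qclassK -[v]qclassK -[w]qclassK.
move: (repr u) (repr v) (repr w) => x y z.
by rewrite -(qmulE y z) -(qmulE x y) -(qmulE x (y * z)) -(qmulE (x * y) z) mulrA.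
Qed.
Let qmul1r : left_id (qclass 1) qmul.
Proof. by move=> u; rewrite -[u]qclassK -qmulE mul1r. Qed.
Let qmulr1 : right_id (qclass 1) qmul.
Proof. by move=> u; rewrite -[u]qclassK -qmulE mulr1. Qed.
Let qmulDl : left_distributive qmul +%R.
Proof.
move=> u v w; rewrite -[u]qclassK -[v]qclassK -[w]qclassK.
move: (repr u) (repr v) (repr w) => x y z.
by rewrite -(qclassD x) -(qmulE _ z) -(qmulE x) -(qmulE y) -qclassD mulrDl.
Qed.
Let qmulDr : right_distributive qmul +%R.
Proof.
move=> u v w; rewrite -[u]qclassK -[v]qclassK -[w]qclassK.
move: (repr u) (repr v) (repr w) => x y z.
by rewrite -(qclassD y) -(qmulE x) -(qmulE x y) -(qmulE x z) -qclassD mulrDr.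
Qed.
Let qone_neq0 : qclass 1 != 0.
Proof.
have <- : qclass 0 = 0 by exact: raddf0.
by apply/eqP => /qclassP; rewrite subr0; exact: rel_proper.
Qed.

HB.instance Definition _ := GRing.Zmodule_isNzRing.Build quot_alg
  qmulA qmul1r qmulr1 qmulDl qmulDr qone_neq0.

Lemma qclassM : {morph qclass : x y / x * y}. Proof. exact: qmulE. Qed.

Let qscaleA a b u : qscale a (qscale b u) = qscale (a * b) u.
Proof. by rewrite -[u]qclassK -!qscaleE scalerA. Qed.
Let qscale1 : left_id 1 qscale.
Proof. by move=> u; rewrite -[u]qclassK -qscaleE scale1r. Qed.
Let qscaleDr : right_distributive qscale +%R.
Proof.
move=> a u v; rewrite -[u]qclassK -[v]qclassK.
by rewrite -!qscaleE -!qclassD -qscaleE scalerDr.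
Qed.
Let qscaleDl u : {morph qscale^~ u : a b / a + b}.
Proof. by move=> a b; rewrite -[u]qclassK -!qscaleE -qclassD scalerDl. Qed.
HB.instance Definition _ := GRing.Zmodule_isLmodule.Build K quot_alg
  qscaleA qscale1 qscaleDr qscaleDl.

Lemma qclassZ c : {morph qclass : x / c *: x}. Proof. exact: qscaleE. Qed.

Let qscaleAl (c : K) (u v : quot_alg) : c *: (u * v) = (c *: u) * v.
Proof.
by rewrite -[u]qclassK -[v]qclassK -qclassM -!qclassZ -qclassM -scalerAl.
Qed.
HB.instance Definition _ := GRing.Lmodule_isLalgebra.Build K quot_alg qscaleAl.

Let qscaleAr (c : K) (u v : quot_alg) : c *: (u * v) = u * (c *: v).
Proof.
by rewrite -[u]qclassK -[v]qclassK -qclassM -!qclassZ -qclassM -scalerAr.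
Qed.
HB.instance Definition _ := GRing.Lalgebra_isAlgebra.Build K quot_alg qscaleAr.

Let qclass_linear : linear qclass.
Proof. by move=> a x y; rewrite qclassD qclassZ. Qed.
Let qclass_monoid : monoid_morphism qclass.
Proof. by split; [reflexivity|exact: qclassM]. Qed.
HB.instance Definition _ := GRing.isLinear.Build K A quot_alg _ qclass
  qclass_linear.
HB.instance Definition _ := GRing.isMonoidMorphism.Build A quot_alg qclass
  qclass_monoid.

Lemma qclass_rel l r : relator P l r -> qclass l = qclass r.
Proof.
by move=> lr; apply/qclassP; rewrite -[_ - _]mulr1 -[_ - _]mul1r;
  exact: rel_ideal_gen.
Qed.

End QuotientAlgebra.

Lemma rel_ideal_eval0 (K : fieldType) (A : algType K) (R : A -> A -> Prop)
    (S : nzRingType) (ev : A -> S) :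
  zmod_morphism ev -> monoid_morphism ev ->
  (forall l r, R l r -> ev l = ev r) -> forall x, rel_ideal R x -> ev x = 0.
Proof.
move=> evB [_ evM] evR x.
have ev0 : ev 0 = 0 by rewrite -(subrr 0) evB subrr.
elim=> [l r a b /evR lr|//|y z _ IHy _ IHz].
  by rewrite !evM evB lr subrr mulr0 mul0r.
by rewrite -[z]opprK evB IHy -[- z]sub0r evB ev0 IHz !subr0.
Qed.

Section QuotientLift.
Context (K : fieldType) (A : algType K) (P : relations A).
Context (S : nzRingType) (ev : A -> S).

(* If [ev] is a morphism that identifies related elements, this is the morphism
   induced on the quotient, see [quot_lift_class]. *)
Definition quot_lift (u : quot_alg P) : S := ev (repr u).

Hypothesis evB : zmod_morphism ev.
Hypothesis evM : monoid_morphism ev.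
Hypothesis ev_rel : forall l r, relator P l r -> ev l = ev r.

Lemma quot_lift_class x : quot_lift (qclass P x) = ev x.
Proof.
apply/eqP; rewrite -subr_eq0 /quot_lift -evB; apply/eqP.
apply: (rel_ideal_eval0 evB evM ev_rel).
by apply/qclassP; rewrite qclassK.
Qed.

Lemma quot_lift_zmod : zmod_morphism quot_lift.
Proof.
move=> u v; rewrite -[u]qclassK -[v]qclassK -raddfB !quot_lift_class.
exact: evB.
Qed.

Lemma quot_lift_monoid : monoid_morphism quot_lift.
Proof.
split=> [|u v]; first by rewrite -evM.1 -quot_lift_class.
rewrite -[u]qclassK -[v]qclassK -qclassM !quot_lift_class.
exact: evM.2.
Qed.

End QuotientLift.

Section FreeAlgebra.
Context (K : fieldType) (X : choiceType).

Definition free_alg := {malg K[{fmonom X}]}.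
HB.instance Definition _ := GRing.Lalgebra.on free_alg.

Definition free_gen (x : X) : free_alg := << fmu x >>.

Lemma free_scaleAr (c : K) (x y : free_alg) : c *: (x * y) = x * (c *: y).
Proof.
have CC (z : free_alg) : z * c%:MP = c%:MP * z.
  rewrite (monalgE z) mulr_suml mulr_sumr; apply: eq_bigr => k _.
  by rewrite !malgM_def !fgmulUU mulm1 mul1m mulrC.
by rewrite -!mul_malgC mulrA -CC -mulrA.
Qed.
HB.instance Definition _ := GRing.Lalgebra_isAlgebra.Build K free_alg free_scaleAr.

Context (S : nzRingType) (sc : {rmorphism K -> S}) (f : X -> S).

Definition word_eval (w : {fmonom X}) : S := \prod_(x <- w) f x.

Lemma word_eval_mmorphism : mmorphism word_eval.
Proof.
split=> [v w|]; rewrite /word_eval; first by rewrite fmM big_cat.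
by rewrite fm1 big_nil.
Qed.
HB.instance Definition _ := isMultiplicative.Build _ _ word_eval
  word_eval_mmorphism.

Definition free_eval (x : free_alg) : S := mmap sc word_eval x.

Lemma free_eval_zmod : zmod_morphism free_eval.
Proof. by move=> x y; rewrite /free_eval mmapB. Qed.

Lemma free_evalZ c x : free_eval (c *: x) = sc c * free_eval x.
Proof. exact: mmapZ. Qed.

Lemma free_eval_gen x : free_eval (free_gen x) = f x.
Proof.
rewrite /free_eval mmapU /word_eval fmU big_seq1.
by rewrite -[RHS]mul1r; congr (_ * _); exact: (rmorph1 sc).
Qed.

Hypothesis scC : forall c s, GRing.comm (sc c) s.

Lemma free_eval_monoid : monoid_morphism free_eval.
Proof.
have [hM h1] := @commr_mmap_is_multiplicative _ _ _ sc word_eval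
  (fun _ _ _ => scC _ _).
by split; [exact: h1|exact: hM].
Qed.

End FreeAlgebra.


(* The two-sided inverse of x, when there is one. *)
Definition rinv (A : nzRingType) (x : A) : A :=
  xget 0 [set y | x * y = 1 /\ y * x = 1].

Lemma rinvP (A : nzRingType) (x : A) :
  (exists y, x * y = 1 /\ y * x = 1) -> x * rinv x = 1 /\ rinv x * x = 1.
Proof. by case=> y xy; exact: (xgetI (P := [set y | x * y = 1 /\ y * x = 1]) 0 xy). Qed.

Section PresentedGroup.
Context (X : choiceType).

(* A letter (x, false) stands for x and (x, true) for its inverse. *)
Definition word := seq (X * bool).

Context (rel : word -> word -> Prop).

Inductive word_cong : word -> word -> Prop :=
| word_cong_refl s : word_cong s s
| word_cong_sym s t : word_cong s t -> word_cong t s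
| word_cong_trans s t u : word_cong s t -> word_cong t u -> word_cong s u
| word_cong_cancel s t x b :
    word_cong (s ++ (x, b) :: (x, ~~ b) :: t) (s ++ t)
| word_cong_rel s t l r : rel l r -> word_cong (s ++ l ++ t) (s ++ r ++ t).

Definition word_congb (s t : word) : bool := `[< word_cong s t >].

Fact word_cong_equiv : equiv_class_of word_congb.
Proof.
split=> [s|s t|t s u].
- exact/asboolP/word_cong_refl.
- by apply/asboolP/asboolP; exact: word_cong_sym.
- by move=> /asboolP st /asboolP tu; apply/asboolP/(word_cong_trans st tu).
Qed.

Canonical word_cong_equiv_rel := EquivRelPack word_cong_equiv.
Canonical word_cong_encModRel := defaultEncModRel word_congb.

Definition presented_group : Type := {eq_quot word_congb}.
HB.instance Definition _ := Choice.on presented_group.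
HB.instance Definition _ := EqQuotient.on presented_group.

Definition wclass (s : word) : presented_group := \pi s.

Lemma wclassP s t : wclass s = wclass t <-> word_cong s t.
Proof.
split=> [/eqP|st]; rewrite /wclass ?eqmodE; first by move/asboolP.
by apply/eqP; rewrite eqmodE; apply/asboolP.
Qed.

Lemma wclassK g : wclass (repr g) = g. Proof. exact: reprK. Qed.

Lemma word_cong_ctx u v s t : word_cong s t -> word_cong (u ++ s ++ v) (u ++ t ++ v).
Proof.
elim=> {s t} [s|s t _|s t w _ IH1 _|s t x b|s t l r lr].
- exact: word_cong_refl.
- exact: word_cong_sym.
- exact: word_cong_trans IH1.
- by rewrite -!catA !(catA u s); exact: word_cong_cancel.
- by rewrite -!catA !(catA u s); exact: word_cong_rel.
Qed.

Lemma word_cong_cat s t s' t' :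
  word_cong s s' -> word_cong t t' -> word_cong (s ++ t) (s' ++ t').
Proof.
move=> ss' tt'; apply: (@word_cong_trans _ (s' ++ t)).
  exact: (word_cong_ctx [::] t ss').
by have := word_cong_ctx s' [::] tt'; rewrite !cats0.
Qed.

Definition word_inv (s : word) : word := rev [seq (l.1, ~~ l.2) | l <- s].

Lemma word_invK : involutive word_inv.
Proof.
move=> s; rewrite /word_inv map_rev revK -map_comp -[RHS]map_id.
by apply: eq_map => -[x b] /=; rewrite negbK.
Qed.

Lemma word_cong_mulV s : word_cong (s ++ word_inv s) [::].
Proof.
elim/last_ind: s => [|s [x b] IH]; first exact: word_cong_refl.
rewrite /word_inv map_rcons rev_rcons cat_rcons /=.
exact: word_cong_trans (word_cong_cancel _ _ _ _) IH.
Qed.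

Lemma word_cong_Vmul s : word_cong (word_inv s ++ s) [::].
Proof. by have := word_cong_mulV (word_inv s); rewrite word_invK. Qed.

Lemma word_cong_inv s t : word_cong s t -> word_cong (word_inv s) (word_inv t).
Proof.
move=> st; apply: (@word_cong_trans _ (word_inv s ++ (t ++ word_inv t))).
  rewrite -{1}[word_inv s]cats0; apply: word_cong_cat (word_cong_refl _) _.
  exact/word_cong_sym/word_cong_mulV.
apply: (@word_cong_trans _ ((word_inv s ++ s) ++ word_inv t)).
  rewrite -catA; apply: word_cong_cat (word_cong_refl _) _.
  exact: word_cong_cat (word_cong_sym st) (word_cong_refl _).
exact: (word_cong_cat (word_cong_Vmul s) (word_cong_refl _)).
Qed.

Let pmul (g h : presented_group) := wclass (repr g ++ repr h).
Let pinv (g : presented_group) := wclass (word_inv (repr g)).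

Let pmulE s t : wclass (s ++ t) = pmul (wclass s) (wclass t).
Proof.
by apply/wclassP/word_cong_cat; apply/wclassP; rewrite wclassK.
Qed.
Let pinvE s : wclass (word_inv s) = pinv (wclass s).
Proof. by apply/wclassP/word_cong_inv/wclassP; rewrite wclassK. Qed.

Let pmulA : associative pmul.
Proof.
move=> g h k; rewrite -[g]wclassK -[h]wclassK -[k]wclassK.
move: (repr g) (repr h) (repr k) => s t u.
by rewrite -(pmulE t u) -(pmulE s t) -(pmulE s (t ++ u)) -(pmulE (s ++ t) u) catA.
Qed.
Let pmul1 : left_id (wclass [::]) pmul.
Proof. by move=> g; rewrite -[g]wclassK -pmulE. Qed.
Let pmulr1 : right_id (wclass [::]) pmul.
Proof. by move=> g; rewrite -[g]wclassK -pmulE cats0. Qed.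
Let pmulV : left_inverse (wclass [::]) pinv pmul.
Proof.
move=> g; rewrite -[g]wclassK -pinvE -pmulE.
exact/wclassP/word_cong_Vmul.
Qed.
Let pmulrV : right_inverse (wclass [::]) pinv pmul.
Proof.
move=> g; rewrite -[g]wclassK -pinvE -pmulE.
exact/wclassP/word_cong_mulV.
Qed.

HB.instance Definition _ := isGroup.Build presented_group
  pmulA pmul1 pmulr1 pmulV pmulrV.

Section Eval.
Context (A : nzRingType) (f : X -> A).

Definition letter_eval (l : X * bool) : A := if l.2 then rinv (f l.1) else f l.1.

(* The morphism to the units of A extending f, as soon as the values of f are
   units that satisfy the relations, see [group_evalM]. *)
Definition group_eval (g : presented_group) : A :=
  \prod_(l <- repr g) letter_eval l.

Hypothesis f_unit : forall x, exists y, f x * y = 1 /\ y * f x = 1.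
Hypothesis f_rel : forall l r, rel l r ->
  \prod_(x <- l) letter_eval x = \prod_(x <- r) letter_eval x.

Lemma group_eval_class s : group_eval (wclass s) = \prod_(l <- s) letter_eval l.
Proof.
suff cE t u : word_cong t u ->
    \prod_(l <- t) letter_eval l = \prod_(l <- u) letter_eval l.
  by apply: cE; apply/wclassP; rewrite wclassK.
elim=> {t u} [//|t u _ ->//|t u v _ -> _ ->//|t u x b|t u l r lr].
  have [fV Vf] := rinvP (f_unit x).
  rewrite !big_cat !big_cons /= (mulrA (letter_eval _)).
  by case: b; rewrite /letter_eval /= ?fV ?Vf mul1r.
by rewrite !big_cat /= (f_rel lr).
Qed.

Lemma group_eval1 : group_eval 1%g = 1.
Proof. by rewrite (group_eval_class [::]) big_nil. Qed.

Lemma group_evalM g h : group_eval (g * h)%g = group_eval g * group_eval h.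
Proof.
rewrite -[g]wclassK -[h]wclassK.
have -> : (wclass (repr g) * wclass (repr h))%g = wclass (repr g ++ repr h).
  by symmetry; exact: pmulE.
by rewrite !group_eval_class big_cat.
Qed.

End Eval.
End PresentedGroup.

Section YokonumaHecke.
Context (K : fieldType) (d n : nat).

(* Strands are numbered from 0: [inl i] is the generator that exchanges strands
   i and i + 1, and [inr j] is the framing generator of strand j. *)
Definition strand_gen : choiceType := ('I_n.-1 + 'I_n)%type.

Fact lower_subproof (i : 'I_n.-1) : (i < n)%N.
Proof. exact: leq_trans (ltn_ord i) (leq_pred n). Qed.
Fact upper_subproof (i : 'I_n.-1) : (i.+1 < n)%N.
Proof. by have := ltn_ord i; rewrite ltn_predRL. Qed.
Definition lower i := Ordinal (lower_subproof i).
Definition upper i := Ordinal (upper_subproof i).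
Definition adj_swap (i : 'I_n.-1) : {perm 'I_n} := tperm (lower i) (upper i).

End YokonumaHecke.

(* y ^+ (d - s) stands for y ^- s: the relation y ^+ d = 1 holds wherever this
   is used. *)
Definition frame_idem (K : fieldType) (d : nat) (A : algType K) (x y : A) : A :=
  d%:R^-1 *: \sum_(0 <= s < d) x ^+ s * y ^+ (d - s).

(* Both families of algebras have a quadratic relation of the form
   g_i^2 = a + b e_i + c e_i g_i. *)
Section YokonumaHeckeRelations.
Context (K : fieldType) (d n : nat) (a b c : K) (A : algType K).
Context (g : 'I_n.-1 -> A) (t : 'I_n -> A).

Let e (i : 'I_n.-1) : A := frame_idem d (t (lower i)) (t (upper i)).

Inductive YH_rel : A -> A -> Prop :=
| YH_far (i j : 'I_n.-1) of (i.+1 < j)%N : YH_rel (g i * g j) (g j * g i)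
| YH_braid (i j : 'I_n.-1) of (j = i.+1 :> nat) :
    YH_rel (g i * g j * g i) (g j * g i * g j)
| YH_comm i j : YH_rel (t i * t j) (t j * t i)
| YH_slide i j : YH_rel (g i * t j) (t (adj_swap i j) * g i)
| YH_order j : YH_rel (t j ^+ d) 1
| YH_quad i : YH_rel (g i ^+ 2) (a%:A + b *: e i + c *: (e i * g i)).

Context (S : nzRingType) (sc : {rmorphism K -> S}).
Context (f : strand_gen n -> S).
Let fe (i : 'I_n.-1) : S := sc d%:R^-1 *
  \sum_(0 <= s < d) f (inr (lower i)) ^+ s * f (inr (upper i)) ^+ (d - s).

Lemma YH_rel_eval (ev : {rmorphism A -> S}) :
  (forall x u, ev (x *: u) = sc x * ev u) ->
  (forall i, ev (g i) = f (inl i)) -> (forall j, ev (t j) = f (inr j)) ->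
  (forall i j : 'I_n.-1, (i.+1 < j)%N ->
     f (inl i) * f (inl j) = f (inl j) * f (inl i)) ->
  (forall i j : 'I_n.-1, j = i.+1 :> nat ->
     f (inl i) * f (inl j) * f (inl i) = f (inl j) * f (inl i) * f (inl j)) ->
  (forall i j : 'I_n, f (inr i) * f (inr j) = f (inr j) * f (inr i)) ->
  (forall i j, f (inl i) * f (inr j) = f (inr (adj_swap i j)) * f (inl i)) ->
  (forall j, f (inr j) ^+ d = 1) ->
  (forall i, f (inl i) ^+ 2 =
     sc a + sc b * fe i + sc c * (fe i * f (inl i))) ->
  forall l r, YH_rel l r -> ev l = ev r.
Proof.
move=> evZ evg evt far braid tt gt td quad.
have eve i : ev (e i) = fe i.
  rewrite evZ rmorph_sum; congr (_ * _); apply: eq_bigr => s _.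
  by rewrite rmorphM !rmorphXn !evt.
move=> l r; case=> [i j ij|i j ij|i j|i j|j|i].
- by rewrite !rmorphM !evg; exact: far.
- by rewrite !rmorphM !evg; exact: braid.
- by rewrite !rmorphM !evt; exact: tt.
- by rewrite !rmorphM !evg !evt; exact: gt.
- by rewrite rmorphXn rmorph1 evt; exact: td.
rewrite rmorphXn evg quad !rmorphD (evZ a) (evZ b) (evZ c) rmorphM eve evg.
by rewrite (rmorph1 ev) mulr1.
Qed.

End YokonumaHeckeRelations.

Section YokonumaHeckeAlgebra.
Context (K : fieldType) (d n : nat) (a b c : K).

Local Notation F := (free_alg K (strand_gen n)).

Definition YH_free_rel : F -> F -> Prop :=
  YH_rel d a b c (fun i => free_gen K (inl i)) (fun j => free_gen K (inr j)).

Section Eval.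
Context (S : nzRingType) (sc : {rmorphism K -> S}) (f : strand_gen n -> S).
Hypothesis scC : forall x s, GRing.comm (sc x) s.

Let fe (i : 'I_n.-1) : S := sc d%:R^-1 *
  \sum_(0 <= s < d) f (inr (lower i)) ^+ s * f (inr (upper i)) ^+ (d - s).

Lemma YH_free_rel_eval :
  (forall i j : 'I_n.-1, (i.+1 < j)%N ->
     f (inl i) * f (inl j) = f (inl j) * f (inl i)) ->
  (forall i j : 'I_n.-1, j = i.+1 :> nat ->
     f (inl i) * f (inl j) * f (inl i) = f (inl j) * f (inl i) * f (inl j)) ->
  (forall i j : 'I_n, f (inr i) * f (inr j) = f (inr j) * f (inr i)) ->
  (forall i j, f (inl i) * f (inr j) = f (inr (adj_swap i j)) * f (inl i)) ->
  (forall j, f (inr j) ^+ d = 1) ->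
  (forall i, f (inl i) ^+ 2 =
     sc a + sc b * fe i + sc c * (fe i * f (inl i))) ->
  forall l r, YH_free_rel l r -> free_eval sc f l = free_eval sc f r.
Proof.
pose ev : {rmorphism F -> S} := HB.pack (free_eval sc f)
  (GRing.isZmodMorphism.Build _ _ _ (free_eval_zmod sc f))
  (GRing.isMonoidMorphism.Build _ _ _ (free_eval_monoid f scC)).
apply: (YH_rel_eval (ev := ev)).
- exact: free_evalZ.
- by move=> i; exact: free_eval_gen.
- by move=> j; exact: free_eval_gen.
Qed.

End Eval.

(* Send every t_j to 1 and every g_i to a companion matrix of the quadratic
   relation. *)
Fact YH_proper : ~ rel_ideal YH_free_rel 1.
Proof.
pose ep : K := d%:R^-1 * d%:R.
pose M : 'M[K]_2 := \matrix_(i, j)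
  if i == 0 then (j == 1)%:R else
  if j == 0 then a + b * ep else c * ep.
pose sc : {rmorphism K -> 'M[K]_2} := @scalar_mx K 2.
have scC x (s : 'M[K]_2) : GRing.comm (sc x) s.
  by rewrite /GRing.comm; exact/esym/scalar_mxC.
pose f (x : strand_gen n) : 'M[K]_2 := if x is inl _ then M else 1.
have fe : sc d%:R^-1 * \sum_(0 <= s < d) 1 ^+ s * 1 ^+ (d - s) = sc ep.
  under eq_bigr do rewrite !expr1n mulr1.
  by rewrite sumr_const_nat subn0 -(rmorph_nat sc) -rmorphM.
have fR l r : YH_free_rel l r -> free_eval sc f l = free_eval sc f r.
  move: l r; apply: (YH_free_rel_eval scC) => //= [i j|j|i].
  - by rewrite mulr1 mul1r.
  - exact: expr1n.
  rewrite fe -!(rmorphM sc) -(rmorphD sc) mulrA -(rmorphM sc).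
  have scM x : sc x * M = x *: M by exact: mul_scalar_mx.
  have -> : M ^+ 2 = M *m M by exact: expr2.
  rewrite scM; apply/matrixP => i1 i2.
  rewrite !mxE big_ord_recr big_ord1 !mxE /=.
  case: i1 => -[|[|//]] ?; case: i2 => -[|[|//]] ? /=.
  all: rewrite ?(mulr0, mul0r, mulr1, mul1r, mulr1n, mulr0n, addr0, add0r) //.
move=> I1; have := rel_ideal_eval0 (free_eval_zmod sc f)
  (free_eval_monoid f scC) fR I1.
by rewrite (free_eval_monoid f scC).1 => /eqP; rewrite oner_eq0.
Qed.

Definition YH_relations := Relations YH_proper.
Definition YH : algType K := quot_alg YH_relations.

Definition braid_gen (i : 'I_n.-1) : YH := qclass YH_relations (free_gen K (inl i)).
Definition frame_gen (j : 'I_n) : YH := qclass YH_relations (free_gen K (inr j)).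
Definition idem_gen (i : 'I_n.-1) : YH :=
  frame_idem d (frame_gen (lower i)) (frame_gen (upper i)).

(* The morphism sending the generators to their images under f (and scalars
   through sc) as soon as these images satisfy the defining relations, see
   [YH_lift_zmod], [YH_lift_monoid], [YH_liftZ]. *)
Definition YH_lift (S : nzRingType) (sc : {rmorphism K -> S})
    (f : strand_gen n -> S) (x : YH) : S := quot_lift (free_eval sc f) x.

End YokonumaHeckeAlgebra.

Arguments braid_gen {K d n a b c} i.
Arguments frame_gen {K d n a b c} j.
Arguments idem_gen {K d n a b c} i.

Section YHLift.
Context (K : fieldType) (d n : nat) (a b c : K).
Context (S : nzRingType) (sc : {rmorphism K -> S}) (f : strand_gen n -> S).
Hypothesis scC : forall x s, GRing.comm (sc x) s.
Hypothesis f_rel : forall l r, YH_free_rel d a b c l r ->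
  free_eval sc f l = free_eval sc f r.

Let evB := free_eval_zmod sc f.
Let evM := free_eval_monoid f scC.
Local Notation P := (YH_relations d n a b c).
Local Notation lift := (YH_lift sc f : YH d n a b c -> S).

Lemma YH_lift_zmod : zmod_morphism lift.
Proof. exact (quot_lift_zmod (P := P) evB evM f_rel). Qed.

Lemma YH_lift_monoid : monoid_morphism lift.
Proof. exact (quot_lift_monoid (P := P) evB evM f_rel). Qed.

Lemma YH_lift_braid i : lift (braid_gen i) = f (inl i).
Proof.
exact (etrans (quot_lift_class (P := P) evB evM f_rel _) (free_eval_gen _ _ _)).
Qed.

Lemma YH_lift_frame j : lift (frame_gen j) = f (inr j).
Proof.
exact (etrans (quot_lift_class (P := P) evB evM f_rel _) (free_eval_gen _ _ _)).
Qed.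

Lemma YH_liftZ x u : lift (x *: u) = sc x * lift u.
Proof.
have [v ->] : exists v, u = qclass P v by exists (repr (u : quot_alg P)); rewrite qclassK.
have <- : qclass P (x *: v) = x *: qclass P v by exact: qclassZ.
by rewrite /YH_lift !(quot_lift_class (P := P) evB evM f_rel) free_evalZ.
Qed.

End YHLift.

Definition YH_widen (K : fieldType) (d n : nat) (a b c : K) (x : YH d n a b c) : YH d n.+1 a b c :=
  YH_lift (in_alg (YH d n.+1 a b c)) (fun y => match y with
    | inl i => braid_gen (n := n.+1) (widen_ord (leq_pred n) i)
    | inr j => frame_gen (widen_ord (leqnSn n) j)
    end) x.

Definition Ytilde (K : fieldType) (d : nat) (q : K) (n : nat) : algType K :=
  YH d n 1 (q - 1) (q - 1).

Definition Yalg (K : fieldType) (d : nat) (u v : K) (n : nat) : algType K :=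
  YH d n (u ^+ 2) 0 v.

Definition Ytilde_base_change (K : fieldType) (L : fieldExtType K) d (q : K) n
    (x : Ytilde d q n) : Ytilde d (q%:A : L) n :=
  YH_lift (in_alg (Ytilde d (q%:A : L) n) \o in_alg L) (fun y => match y with
    | inl i => braid_gen i
    | inr j => frame_gen j
    end) x.

Section BaseField.
Context (R : realType).

(* C(sqrt q, z), where the inner variable is sqrt q and the outer one is z. *)
Definition kfield : fieldType := {fraction {poly {poly R[i]}}}.
Definition sqrtq : kfield := tofrac ('X%:P).
Definition qk : kfield := sqrtq ^+ 2.
Definition zk : kfield := tofrac 'X.
Definition constk (x : R[i]) : kfield := tofrac (x%:P%:P).

Context (d : nat) (S : {set 'I_d}).

Definition root_mean (xi : 'I_d -> R[i]) (b : nat) : R[i] :=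
  #|S|%:R^-1 * \sum_(a in S) xi a ^+ b.

Definition Ecst : kfield := #|S|%:R^-1.
Definition lambdaS : kfield := (zk + (1 - qk) * Ecst) / (qk * zk).

(* Functions on the chain are families (tr n) compatible with the natural maps
   from rank n to rank n + 1; a condition n >= 1 appears as an index n.+1. *)
Record is_JL_trace (xi : 'I_d -> R[i]) (tr : forall n, Ytilde d qk n -> kfield) :
    Prop := IsJLTrace {
  JL_linear : forall n, scalar (tr n);
  JL_chain : forall n x, tr n.+1 (YH_widen x) = tr n x;
  JL_one : forall n, tr n 1 = 1;
  JL_trace : forall n (x y : Ytilde d qk n.+1), tr n.+1 (x * y) = tr n.+1 (y * x);
  JL_braid : forall n (x : Ytilde d qk n.+1),
    tr n.+2 (YH_widen x * braid_gen (n := n.+2) ord_max) = zk * tr n.+1 x;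
  JL_frame : forall n (x : Ytilde d qk n) b, (b < d)%N ->
    tr n.+1 (YH_widen x * frame_gen ord_max ^+ b) =
      constk (root_mean xi b) * tr n x
}.

End BaseField.

Section FramedBraids.
Context (d n : nat).

Local Notation sg i := [:: (inl i : strand_gen n, false)].
Local Notation fr j := [:: (inr j : strand_gen n, false)].

Inductive framed_braid_rel :
    word (strand_gen n) -> word (strand_gen n) -> Prop :=
| FB_far (i j : 'I_n.-1) of (i.+1 < j)%N :
    framed_braid_rel (sg i ++ sg j) (sg j ++ sg i)
| FB_braid (i j : 'I_n.-1) of (j = i.+1 :> nat) :
    framed_braid_rel (sg i ++ sg j ++ sg i) (sg j ++ sg i ++ sg j)
| FB_comm (i j : 'I_n) : framed_braid_rel (fr i ++ fr j) (fr j ++ fr i)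
| FB_slide (i : 'I_n.-1) (j : 'I_n) :
    framed_braid_rel (sg i ++ fr j) (fr (adj_swap i j) ++ sg i)
| FB_order (j : 'I_n) : framed_braid_rel (nseq d (inr j, false)) [::].

Definition framed_braid_group : groupType :=
  presented_group framed_braid_rel.

End FramedBraids.

Section Links.
Context (R : realType) (d : nat).

(* An oriented polygonal link in R^3 is given by the cyclic order of its vertices
   on each component; the edges are the segments from v to [next_vertex v], the
   components are the cycles of [next_vertex], and a framing is a function on
   vertices that is constant on each component. 'I_d.-1.+1 is the additive group
   Z/d, including for d = 1. *)
Record framed_polygon := FramedPolygon {
  vertex : finType;
  position : vertex -> 'rV[R]_3;
  next_vertex : vertex -> vertex;
  framing : vertex -> 'I_d.-1.+1
}.

Definition edge_point (K : framed_polygon) (v : vertex K) (s : R) : 'rV[R]_3 :=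
  (1 - s) *: position v + s *: position (next_vertex v).

Record is_framed_link (K : framed_polygon) : Prop := IsFramedLink {
  link_nonempty : (0 < #|vertex K|)%N;
  link_cycles : injective (@next_vertex K);
  (* The half-open edges are nondegenerate and pairwise disjoint. *)
  link_embedded : forall (v w : vertex K) (s t : R),
    0 <= s < 1 -> 0 <= t < 1 -> edge_point v s = edge_point w t ->
    v = w /\ s = t;
  link_framing : forall v : vertex K, framing (next_vertex v) = framing v
}.

Definition in_triangle (a b c x : 'rV[R]_3) : Prop :=
  exists r s : R, [/\ 0 <= r, 0 <= s, r + s <= 1 &
    x = (1 - r - s) *: a + r *: b + s *: c].

Definition insert_vertex (K : framed_polygon) (a : vertex K) (c : 'rV[R]_3) :
    framed_polygon := {|
  vertex := option (vertex K);
  position v := if v is Some w then position w else c;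
  next_vertex v :=
    if v is Some w then if w == a then None else Some (next_vertex w)
    else Some (next_vertex a);
  framing v := if v is Some w then framing w else framing a
|}.

(* Combinatorial isotopy: an edge may be replaced by the other two sides of a
   triangle that meets the link in that edge only, and conversely. *)
Inductive isotopic : framed_polygon -> framed_polygon -> Prop :=
| isotopic_relabel K L (f : vertex K -> vertex L) of
    is_framed_link K & bijective f &
    (forall v, position (f v) = position v) &
    (forall v, next_vertex (f v) = f (next_vertex v)) &
    (forall v, framing (f v) = framing v) : isotopic K L
| isotopic_triangle K (a : vertex K) (c : 'rV[R]_3) of
    is_framed_link K & is_framed_link (insert_vertex a c) &
    (forall (v : vertex K) (s : R), 0 <= s < 1 ->
       in_triangle (position a) c (position (next_vertex a)) (edge_point v s) ->
       v = a \/ edge_point v s = position (next_vertex a)) :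
    isotopic K (insert_vertex a c)
| isotopic_sym K L of isotopic K L : isotopic L K
| isotopic_trans K L M of isotopic K L & isotopic L M : isotopic K M.

Definition framed_link := {K : framed_polygon | is_framed_link K}.

(* The closure of a braid word w with m letters on n strands, projected on the
   plane of the first two coordinates.  The braid goes upwards between heights 0
   and m, and its k-th letter lies between heights k and k + 1.  In the vertex
   (p, r), p is the position of the strand at the start of the current letter
   and r is the step along the strand: r = 2k <= 2m is height k, r = 2k + 1 < 2m
   is the middle of the k-th letter, and the last four steps lead the strand from
   the top back to the bottom, around the right of the braid.  In the crossing
   of sigma_i (resp. of its inverse) the strand coming from position i passes
   above (resp. below) the other one. *)
Section Closure.
Context (n : nat) (w : word (strand_gen n)).
Let m := size w.

Definition closure_vertex : finType := ('I_n * 'I_(2 * m + 5))%type.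

Definition closure_letter (v : closure_vertex) : option (strand_gen n * bool) :=
  if odd v.2 then onth w v.2./2 else None.

Definition closure_strand (v : closure_vertex) : 'I_n :=
  if closure_letter v is Some (inl i, _) then adj_swap i v.1 else v.1.

Definition closure_next (v : closure_vertex) : closure_vertex :=
  (closure_strand v, ordS v.2).

Definition closure_height (v : closure_vertex) : R :=
  if closure_letter v is Some (inl i, b) then
    (-1) ^+ b * ((v.1 == lower i)%:R - (v.1 == upper i)%:R)
  else 0.

Definition closure_pos (v : closure_vertex) : 'rV[R]_3 :=
  let p : R := (val v.1)%:R in
  let out : R := n%:R - p in
  let top : R := m%:R in
  \row_j nth 0 (match (v.2 - 2 * m)%N with
    | 0 => [:: (p + (val (closure_strand v))%:R) / 2; (val v.2)%:R / 2;
               closure_height v]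
    | 1 => [:: p; top + out; 0]
    | 2 => [:: n%:R + out; top + out; 0]
    | 3 => [:: n%:R + out; - out; 0]
    | _ => [:: p; - out; 0]
    end) j.

(* The contribution of each letter t_j^{+-1} to the framing; the contributions
   met along a component are added in [braid_closure]. *)
Definition closure_mark (v : closure_vertex) : 'I_d.-1.+1 :=
  if closure_letter v is Some (inr j, b) then
    if v.1 == j then if b then - inZp 1 else inZp 1 else 0
  else 0.

Definition braid_closure : framed_polygon := {|
  vertex := closure_vertex;
  position := closure_pos;
  next_vertex := closure_next;
  framing v := \sum_(u | fconnect closure_next v u) closure_mark u
|}.

End Closure.

Definition framed_braid := {n : nat & framed_braid_group d n.+1}.

Definition is_closure_of (b : framed_braid) (K : framed_link) : Prop :=
  exists w, wclass (@framed_braid_rel d (projT1 b).+1) w = projT2 b /\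
    isotopic (braid_closure w) (sval K).

(* A choice K |-> beta K of a braid with closure K, for every K that is the
   closure of a braid; every framed link is, by Alexander's theorem. *)
Definition is_braid_choice (beta : framed_link -> framed_braid) : Prop :=
  forall K b, is_closure_of b K -> is_closure_of (beta K) K.

End Links.

Section Invariants.
Context (R : realType) (d : nat) (S : {set 'I_d}).
Local Notation k := (kfield R).
Context (kS : fieldExtType k) (sl : kS).

Definition sqrtqS : kS := (sqrtq R)%:A.
Definition qS : kS := (qk R)%:A.
Definition uS : kS := sqrtqS * sl.
Definition vS : kS := (qS - 1) * sl.
Definition DS : kS := (sl * (zk R)%:A)^-1.

Definition identification n (x : Yalg d uS vS n) : Ytilde d qS n :=
  YH_lift (in_alg (Ytilde d qS n)) (fun y => match y with
    | inl i => sl *: ((sqrtqS%:A + (1 - sqrtqS) *: idem_gen i) * braid_gen i)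
    | inr j => frame_gen j
    end) x.

Definition rho_tilde (trS : forall n, Ytilde d qS n -> kS) n
    (x : Yalg d uS vS n) : kS :=
  DS ^+ n.-1 * trS n (identification x).

(* [delta_tilde] and [delta_gamma] are the algebra morphisms on the group algebra
   of the framed braid group, restricted to the group itself. *)
Definition delta_tilde n (b : framed_braid_group d n) : Ytilde d qS n :=
  group_eval (fun y => match y with
    | inl i => sl *: braid_gen i
    | inr j => frame_gen j
    end) b.

Definition delta_gamma (gamma : kS) n (b : framed_braid_group d n) :
    Yalg d uS vS n :=
  group_eval (fun y => match y with
    | inl i => (gamma%:A + (1 - gamma) *: idem_gen i) * braid_gen i
    | inr j => frame_gen j
    end) b.

Record is_markov_trace (rho : forall n, Yalg d uS vS n -> kS) : Prop :=
    IsMarkovTrace {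
  markov_linear : forall n, scalar (rho n.+1);
  markov_M1 : forall n (x y : Yalg d uS vS n.+1),
    rho n.+1 (x * y) = rho n.+1 (y * x);
  markov_M2 : forall n (x : Yalg d uS vS n.+1),
    let g : Yalg d uS vS n.+2 := braid_gen (n := n.+2) ord_max in
    rho n.+2 (YH_widen x * g) = rho n.+1 x /\
    rho n.+2 (YH_widen x * rinv g) = rho n.+1 x
}.

Definition FDelta (trS : forall n, Ytilde d qS n -> kS)
    (beta : framed_link R d -> framed_braid d) (K : framed_link R d) : kS :=
  let: existT n b := beta K in DS ^+ n * trS n.+1 (delta_tilde b).

Definition FGamma (gamma : kS) (rho : forall n, Yalg d uS vS n -> kS)
    (beta : framed_link R d -> framed_braid d) (K : framed_link R d) : kS :=
  let: existT n b := beta K in rho n.+1 (delta_gamma gamma b).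

End Invariants.

(* Main.v *)
Require Import Defs.
From HB Require Import structures.
From mathcomp Require Import all_boot all_order all_fingroup all_algebra all_field.
From mathcomp Require Import boolp classical_sets reals complex.
From mathcomp Require Import zify ring.
From mathcomp.multinomials Require Import monalg.
Set Implicit Arguments.
Unset Strict Implicit.
Unset Printing Implicit Defensive.
Import Order.TTheory GRing.Theory Num.Theory.
Local Open Scope ring_scope.

(* Transporting [tr] to the algebra generated by the g_i multiplies g_n by
   [sl (sqrtq + (1 - sqrtq) e_n)], so (M2) reduces to three values of the trace,
   for x in the algebra on n strands: tr (x G_n) = z tr x; tr (x e_n G_n) = z tr x,
   which follows by moving the framings around the trace; and
   tr (x e_n) = E tr x.  The last one rests on the fact that the moments c_b of S
   solve the E-system sum_s c_(d-s) c_(k+s) = d E c_k, and is proved by induction on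
   n along the spanning family x t_(n+1)^k, x G_n y with x, y in the algebra on n
   strands.  Since g_n^-1 = u^-2 (g_n - v e_n), the definitions of lambda_S and D_S
   then give both equalities of (M2).  For (ii),
   (gamma + (1 - gamma) e)(r + (1 - r) e) = gamma r + (1 - gamma r) e, so that with
   gamma = 1/r = 1/sqrtq the image of sigma_i is sl G_i in both constructions. *)

(** * Framing idempotents and braid generators *)

Section FrameIdempotent.
Context (K : fieldType) (d : nat) (A : algType K).
Implicit Types x y : A.

Lemma comm_frame_idem x y z :
  GRing.comm z x -> GRing.comm z y -> GRing.comm z (frame_idem d x y).
Proof.
move=> zx zy; rewrite /GRing.comm /frame_idem -scalerAr -scalerAl; congr (_ *: _).
by apply: commr_sum => s _; apply: commrM; apply: commrX.
Qed.

Lemma frame_idem_conj g x y x' y' :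
  g * x = x' * g -> g * y = y' * g ->
  g * frame_idem d x y = frame_idem d x' y' * g.
Proof.
have conjX u v m : g * u = v * g -> g * u ^+ m = v ^+ m * g.
  by move=> uv; elim: m => [|m IH];
    rewrite ?expr0 ?mulr1 ?mul1r // !exprSr mulrA IH -mulrA uv mulrA.
move=> gx gy; rewrite /frame_idem -scalerAr -scalerAl; congr (_ *: _).
rewrite mulr_sumr mulr_suml; apply: eq_bigr => s _.
by rewrite mulrA (conjX _ _ _ gx) -mulrA (conjX _ _ _ gy) mulrA.
Qed.

Section RootsOfUnity.
Context (x y : A).
Hypothesis (xy : GRing.comm x y) (xd : x ^+ d = 1) (yd : y ^+ d = 1).
Local Notation e := (frame_idem d x y).

(** A cyclic shift of the index: the terms for [s = 0] and [s = d] are both 1, since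
    [x ^+ d = y ^+ d = 1]. *)
Lemma frame_idem_shift :
  \sum_(0 <= s < d) x ^+ s.+1 * y ^+ (d - s.+1) =
  \sum_(0 <= s < d) x ^+ s * y ^+ (d - s).
Proof.
transitivity (\sum_(1 <= s < d.+1) x ^+ s * y ^+ (d - s)).
  by rewrite big_add1.
case: d xd yd => [|m] xm ym; first by rewrite !big_geq.
rewrite big_nat_recr // [RHS]big_nat_recl //= subnn subn0 xm ym !expr0 addrC.
by rewrite mulr1; congr (_ + _); rewrite big_add1.
Qed.

(** Multiplication by [x] turns each term of the sum into [y] times the next one, and the cyclically
    shifted sum is the same element. *)
Lemma frame_idem_mul : x * e = y * e.
Proof.
rewrite /frame_idem -!scalerAr; congr (_ *: _).
rewrite -[in RHS]frame_idem_shift !mulr_sumr.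
apply: eq_big_nat => s /andP[_ sd].
rewrite mulrA -exprS [RHS]mulrA (commrX s.+1 (commr_sym xy)) -mulrA -exprS.
by rewrite -subSn.
Qed.

(** Reversing the order of summation in the shifted sum exchanges the two exponents. *)
Lemma frame_idem_sym : e = frame_idem d y x.
Proof.
rewrite /frame_idem -[in LHS]frame_idem_shift; congr (_ *: _).
rewrite big_nat_rev /=; apply: eq_big_nat => s /andP[_ sd].
rewrite add0n -subSn // subSS subKn; last exact: ltnW.
by apply/commr_sym/commrX/commr_sym/commrX.
Qed.

Lemma frame_idem_idem : e * e = e.
Proof.
have xXe m : x ^+ m * e = y ^+ m * e.
  elim: m => [|m IH]; first by rewrite !expr0.
  rewrite exprSr -mulrA frame_idem_mul mulrA (commr_sym (commrX m (commr_sym xy))).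
  by rewrite -mulrA IH mulrA -exprS.
(* Each term of the average fixes [e]: on [e] it acts as [y ^+ d = 1]. *)
have xye s : (s < d)%N -> x ^+ s * y ^+ (d - s) * e = e.
  move=> sd; rewrite (commrX _ (commr_sym (commrX s (commr_sym xy)))) -mulrA xXe.
  by rewrite mulrA -exprD subnK ?(ltnW sd) // yd mul1r.
rewrite {1}/frame_idem -scalerAl mulr_suml.
rewrite (eq_big_nat _ _ (F2 := fun=> e)) => [|s /andP[_]]; last exact: xye.
rewrite sumr_const_nat subn0 -scaler_nat scalerA.
(* if d = 0 in K, then e = 0 because 0^-1 = 0 *)
have [d0|dN0] := eqVneq (d%:R : K) 0; last by rewrite mulVf ?scale1r.
by rewrite /frame_idem d0 invr0 mul0r !scale0r.
Qed.

End RootsOfUnity.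
End FrameIdempotent.

(** * Consequences of the Yokonuma-Hecke relations, and twisted braid generators *)

Section FrameRelations.
Context (K : fieldType) (d n : nat) (a b c : K) (A : algType K).
Context (g : 'I_n.-1 -> A) (t : 'I_n -> A).
Hypothesis YH_rel_eq : forall l r, YH_rel d a b c g t l r -> l = r.

Local Notation e j k := (frame_idem d (t j) (t k)).
Local Notation s i := (adj_swap i).

Lemma frame_comm j k : GRing.comm (t j) (t k).
Proof. exact/YH_rel_eq/YH_comm. Qed.

Lemma frame_order j : t j ^+ d = 1.
Proof. exact/YH_rel_eq/YH_order. Qed.

Lemma braid_frame i j : g i * t j = t (s i j) * g i.
Proof. exact/YH_rel_eq/YH_slide. Qed.

Lemma braid_frameX i j k : g i * t j ^+ k = t (s i j) ^+ k * g i.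
Proof.
elim: k => [|k IH]; first by rewrite !expr0 mulr1 mul1r.
by rewrite !exprS mulrA braid_frame -mulrA IH mulrA.
Qed.

Lemma braid_quad i :
  g i ^+ 2 = a%:A + b *: e (lower i) (upper i) + c *: (e (lower i) (upper i) * g i).
Proof. exact/YH_rel_eq/YH_quad. Qed.

Lemma frame_comm_idem l j k : GRing.comm (t l) (e j k).
Proof. by apply: comm_frame_idem; exact: frame_comm. Qed.

Lemma idem_comm j k j' k' : GRing.comm (e j k) (e j' k').
Proof. by apply: comm_frame_idem; apply/commr_sym/frame_comm_idem. Qed.

Lemma idem_sym j k : e j k = e k j.
Proof. by apply: frame_idem_sym; [exact: frame_comm|exact: frame_order..]. Qed.

Lemma idem_idem j k : e j k * e j k = e j k.
Proof. by apply: frame_idem_idem; [exact: frame_comm|exact: frame_order..]. Qed.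

Lemma braid_idem i j k : g i * e j k = e (s i j) (s i k) * g i.
Proof. by apply: frame_idem_conj; exact: braid_frame. Qed.

Lemma braid_idem_comm i : GRing.comm (g i) (e (lower i) (upper i)).
Proof. by rewrite /GRing.comm braid_idem tpermL tpermR idem_sym. Qed.

Section Twist.
Context (al be : K).
Local Notation f j k := (al%:A + be *: e j k).

Lemma twist_comm x j k : GRing.comm x (e j k) -> GRing.comm x (f j k).
Proof.
move: (frame_idem _ _ _) => E xE; rewrite /GRing.comm mulrDl mulrDr.
by rewrite -!scalerAl -!scalerAr xE mulr1 mul1r.
Qed.

Lemma twist_twist_comm j k j' k' : GRing.comm (f j k) (f j' k').
Proof. by apply/twist_comm/commr_sym/twist_comm/idem_comm. Qed.

Lemma braid_twist i j k : g i * f j k = f (s i j) (s i k) * g i.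
Proof.
have := braid_idem i j k; move: (e j k) (e (s i j) (s i k)) => E E' gE.
by rewrite mulrDl mulrDr -!scalerAl -!scalerAr gE mulr1 mul1r.
Qed.

Local Notation h i := (f (lower i) (upper i) * g i).

Lemma twisted_far (i j : 'I_n.-1) : (i.+1 < j)%N -> h i * h j = h j * h i.
Proof.
move=> ij; have swE (x : 'I_n) (p : 'I_n.-1) : (x != p :> nat) ->
    (x != p.+1 :> nat) -> s p x = x.
  by move=> xp xp1; rewrite tpermD // -val_eqE eq_sym.
(* Generators that are far apart move neither strand of each other's idempotent. *)
have fx (p q : 'I_n.-1) : (p.+1 < q)%N || (q.+1 < p)%N ->
    g p * f (lower q) (upper q) = f (lower q) (upper q) * g p.
  move=> pq; rewrite braid_twist !swE //=; lia.
rewrite mulrA -(mulrA _ (g i)) fx ?ij // !mulrA twist_twist_comm.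
rewrite -!mulrA; congr (_ * _); rewrite [RHS]mulrA fx ?ij ?orbT // -mulrA.
by congr (_ * _); apply/YH_rel_eq/YH_far.
Qed.

(* With strands p, q, r, both sides equal f_pq f_pr f_qr (g_i g_j g_i). *)
Lemma twisted_braid (i j : 'I_n.-1) :
  j = i.+1 :> nat -> h i * h j * h i = h j * h i * h j.
Proof.
move=> ji; have lu : lower j = upper i by apply: val_inj.
set p := lower i; set q := upper i; set r := upper j.
have [pq pr qr] : [/\ p != q, p != r & q != r].
  by rewrite -!val_eqE /= ji; split; lia.
have gi (u v u' v' : 'I_n) :
  s i u = u' -> s i v = v' -> g i * f u v = f u' v' * g i.
  by move=> <- <-; exact: braid_twist.
have gj (u v u' v' : 'I_n) :
  s j u = u' -> s j v = v' -> g j * f u v = f u' v' * g j.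
  by move=> <- <-; exact: braid_twist.
have iQ : g i * f q r = f p r * g i by apply: gi; rewrite ?tpermR ?tpermD.
have iT : g i * f p r = f q r * g i by apply: gi; rewrite ?tpermL ?tpermD.
have jP : g j * f p q = f p r * g j.
  by apply: gj; rewrite /adj_swap lu ?tpermL // tpermD // eq_sym.
have jT : g j * f p r = f p q * g j.
  by apply: gj; rewrite /adj_swap lu ?tpermR // tpermD // eq_sym.
have gg : g i * g j * g i = g j * g i * g j by exact/YH_rel_eq/YH_braid.
rewrite lu -/q.
move: (f p q) (f q r) (f p r) (twist_twist_comm p q q r) (twist_twist_comm p r q r)
  (twist_twist_comm p q p r) iQ iT jP jT => P Q T PQ TQ PT iQ iT jP jT.
transitivity (P * T * Q * (g i * g j * g i)).
  rewrite -!mulrA; congr (_ * _); rewrite (mulrA (g j)) jP !mulrA iQ; congr (_ * _ * _).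
  by rewrite -!mulrA iT.
transitivity (Q * T * P * (g j * g i * g j)).
  by rewrite gg; congr (_ * _); rewrite PT -mulrA PQ mulrA TQ.
rewrite -!mulrA; congr (_ * _); rewrite [in RHS](mulrA (g i)) iQ !mulrA jP; congr (_ * _ * _).
by rewrite -!mulrA jT.
Qed.

Lemma twisted_slide i j : h i * t j = t (s i j) * h i.
Proof.
rewrite -mulrA braid_frame !mulrA; congr (_ * _).
exact/commr_sym/twist_comm/frame_comm_idem.
Qed.

End Twist.
End FrameRelations.

(** Homogeneity is asked for the single scalar [d%:R^-1], so the two algebras may have different
    ground fields. *)
Lemma map_frame_idem (K L : fieldType) (A : algType K) (B : algType L) (d : nat)
    (phi : {rmorphism A -> B}) :
  (forall x, phi (d%:R^-1 *: x) = d%:R^-1 *: phi x) ->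
  forall x y, phi (frame_idem d x y) = frame_idem d (phi x) (phi y).
Proof.
move=> phiZ x y; rewrite /frame_idem phiZ rmorph_sum; congr (_ *: _).
by apply: eq_bigr => s _; rewrite rmorphM !rmorphXn.
Qed.

(** * Chains of Yokonuma-Hecke algebras *)

Section LiftToAlgebra.
Context (K L : fieldType) (d n : nat) (a b c : K) (B : algType L).
Context (sc : {rmorphism K -> B}) (sigma : {rmorphism K -> L}).
Hypothesis scE : forall x, sc x = (sigma x)%:A.
Context (f : strand_gen n -> B).
Hypothesis f_rel : forall l r,
  YH_rel d (sigma a) (sigma b) (sigma c) (f \o inl) (f \o inr) l r -> l = r.

Lemma scalar_comm x y : GRing.comm (sc x) y.
Proof. by rewrite /GRing.comm scE mulr_algl mulr_algr. Qed.

(** The parameters of the relations are transported by [sigma]. The identity gives morphisms of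
    algebras over one field, and an embedding into a larger field gives the base change. *)
Lemma YH_free_rel_lift l r :
  YH_free_rel d a b c l r -> free_eval sc f l = free_eval sc f r.
Proof.
have feE x y : sc d%:R^-1 * (\sum_(0 <= s < d) x ^+ s * y ^+ (d - s))
    = frame_idem d x y.
  by rewrite scE fmorphV rmorph_nat mulr_algl.
apply: (YH_free_rel_eval scalar_comm).
- by move=> i j ij; exact/f_rel/YH_far.
- by move=> i j ij; exact/f_rel/YH_braid.
- by move=> i j; exact/f_rel/YH_comm.
- by move=> i j; exact/f_rel/YH_slide.
- by move=> j; exact/f_rel/YH_order.
move=> i; rewrite feE !scE !mulr_algl.
exact/f_rel/YH_quad.
Qed.

Local Notation lift := (YH_lift sc f : YH d n a b c -> B).

Lemma alg_lift_zmod : zmod_morphism lift.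
Proof. exact: (YH_lift_zmod scalar_comm YH_free_rel_lift). Qed.

Lemma alg_lift_monoid : monoid_morphism lift.
Proof. exact: (YH_lift_monoid scalar_comm YH_free_rel_lift). Qed.

Lemma alg_liftZ x u : lift (x *: u) = sigma x *: lift u.
Proof. by rewrite (YH_liftZ scalar_comm YH_free_rel_lift) scE mulr_algl. Qed.

Lemma alg_lift_braid i : lift (braid_gen i) = f (inl i).
Proof. exact: (YH_lift_braid scalar_comm YH_free_rel_lift). Qed.

Lemma alg_lift_frame j : lift (frame_gen j) = f (inr j).
Proof. exact: (YH_lift_frame scalar_comm YH_free_rel_lift). Qed.

End LiftToAlgebra.

Lemma YH_rel_image (K : fieldType) (d n : nat) (a b c : K) (A B : algType K)
    (phi : {rmorphism A -> B}) (g : 'I_n.-1 -> A) (t : 'I_n -> A) :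
  scalable phi ->
  (forall x y, YH_rel d a b c g t x y -> phi x = phi y) ->
  forall l r, YH_rel d a b c (phi \o g) (phi \o t) l r -> l = r.
Proof.
move=> phiZ gt l r; case=> [i j ij|i j ij|i j|i j|j|i] /=.
- by rewrite -!rmorphM; exact/gt/YH_far.
- by rewrite -!rmorphM; exact/gt/YH_braid.
- by rewrite -!rmorphM; exact/gt/YH_comm.
- by rewrite -!rmorphM; exact/gt/YH_slide.
- by rewrite -!rmorphXn -(rmorph1 phi); exact/gt/YH_order.
have := gt _ _ (YH_quad _ _ _ _ _ _ i).
rewrite rmorphXn !rmorphD (phiZ a) (phiZ b) (phiZ c) (rmorph1 phi) rmorphM.
by rewrite (map_frame_idem (phiZ _)).
Qed.

Section Relations.
Context (K : fieldType) (d n : nat) (a b c : K).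
Local Notation Y := (YH d n a b c).

Lemma YH_gen_rel (l r : Y) :
  YH_rel d a b c (fun i => braid_gen i) (fun j => frame_gen j) l r -> l = r.
Proof.
apply: (@YH_rel_image K d n a b c _ _ (qclass (YH_relations d n a b c))) => [|x y xy].
  exact: qclassZ.
exact: qclass_rel.
Qed.

(** Left multiplication by single generators suffices: a class is represented by a linear
    combination of words, and a word is built by adding letters on the left. *)
Lemma YH_ind (P : Y -> Prop) :
  P 1 -> (forall x u v, P u -> P v -> P (x *: u + v)) ->
  (forall i u, P u -> P (braid_gen i * u)) ->
  (forall j u, P u -> P (frame_gen j * u)) -> forall u, P u.
Proof.
move=> P1 Plin Pg Pt u.
pose pi : free_alg K (strand_gen n) -> Y := qclass (YH_relations d n a b c).
have piD x y : pi (x + y) = pi x + pi y by exact: qclassD.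
have piZ x y : pi (x *: y) = x *: pi y by exact: qclassZ.
have piM x y : pi (x * y) = pi x * pi y by exact: qclassM.
have pi1 : pi 1 = 1 by [].
have [F ->] : exists F, u = pi F.
  exists (generic_quotient.repr (u : quot_alg (YH_relations d n a b c))).
  by rewrite /pi qclassK.
rewrite [F]monalgE; elim/big_rec: _ => [|w G _ PG].
  have P0 : P 0 by rewrite -(addNr 1) -scaleN1r; exact: Plin.
  suff -> : pi 0 = 0 by [].
  by apply: (addrI (pi 0)); rewrite -piD !addr0.
have -> : << F@_w *g w >> = F@_w *: << w >>.
  by apply/malgP => v; rewrite mcoeffZ !mcoeffU mulrnAr mulr1.
rewrite piD piZ; apply: Plin => //.
case: w => w; elim: w => [|x w IH].
  have -> : FMonom [::] = mone :> {fmonom (strand_gen n)}.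
    by apply: val_inj; rewrite /= fm1.
  exact: P1.
have -> : << FMonom (x :: w) >> = free_gen K x * << FMonom w >>.
  rewrite malgM_def fgmulUU mulr1; congr << _ *g _ >>.
  by apply: val_inj; rewrite /= fmM fmU.
rewrite piM; case: x => [i|j]; [exact: Pg|exact: Pt].
Qed.

End Relations.

Section Widen.
Context (K : fieldType) (d n : nat) (a b c : K).
Local Notation Y m := (YH d m a b c).
Local Notation wg i := (widen_ord (leq_pred n) i : 'I_n.+1.-1).
Local Notation wt j := (widen_ord (leqnSn n) j).

Lemma adj_swap_widen i j : adj_swap (wg i) (wt j) = wt (adj_swap i j).
Proof.
have wl : wt (lower i) = lower (wg i) by exact: val_inj.
have wu : wt (upper i) = upper (wg i) by exact: val_inj.
have [->|jl] := eqVneq j (lower i); first by rewrite /adj_swap tpermL wl wu tpermL.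
have [->|ju] := eqVneq j (upper i); first by rewrite /adj_swap tpermR wl wu tpermR.
by rewrite /adj_swap !tpermD // -?wl -?wu eq_sym.
Qed.

Lemma YH_widen_rel (l r : Y n.+1) :
  YH_rel d a b c (fun i : 'I_n.-1 => braid_gen (wg i)) (fun j => frame_gen (wt j)) l r ->
  l = r.
Proof.
have wl i : wt (lower i) = lower (wg i) by exact: val_inj.
have wu i : wt (upper i) = upper (wg i) by exact: val_inj.
case=> [i j ij|i j ij|i j|i j|j|i]; rewrite ?wl ?wu -?adj_swap_widen.
- exact/YH_gen_rel/YH_far.
- exact/YH_gen_rel/YH_braid.
- exact/YH_gen_rel/YH_comm.
- exact/YH_gen_rel/YH_slide.
- exact/YH_gen_rel/YH_order.
- exact/YH_gen_rel/YH_quad.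
Qed.

Let in_algE (x : K) : in_alg (Y n.+1) x = (idfun x)%:A. Proof. by []. Qed.

Fact YH_widen_zmod : zmod_morphism (@YH_widen K d n a b c).
Proof. exact: (alg_lift_zmod in_algE YH_widen_rel). Qed.
Fact YH_widen_monoid : monoid_morphism (@YH_widen K d n a b c).
Proof. exact: (alg_lift_monoid in_algE YH_widen_rel). Qed.
Fact YH_widen_scalable : scalable (@YH_widen K d n a b c).
Proof. exact: (alg_liftZ in_algE YH_widen_rel). Qed.

HB.instance Definition _ := GRing.isZmodMorphism.Build _ _ _ YH_widen_zmod.
HB.instance Definition _ := GRing.isMonoidMorphism.Build _ _ _ YH_widen_monoid.
HB.instance Definition _ := GRing.isScalable.Build _ _ _ _ _ YH_widen_scalable.

Lemma YH_widen_braid i : YH_widen (braid_gen i : Y n) = braid_gen (wg i).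
Proof. exact: (alg_lift_braid in_algE YH_widen_rel). Qed.
Lemma YH_widen_frame j : YH_widen (frame_gen j : Y n) = frame_gen (wt j).
Proof. exact: (alg_lift_frame in_algE YH_widen_rel). Qed.

End Widen.

(* An abstract copy of the algebras [YH d n a b c] and of the maps between them,
   because unification is intractable on the algebra structures of the quotients. *)
Record YH_chain (K : fieldType) (d : nat) (a b c : K) := YHChain {
  chain_alg :> nat -> algType K;
  chain_braid : forall n, 'I_n.-1 -> chain_alg n;
  chain_frame : forall n, 'I_n -> chain_alg n;
  chain_widen : forall n, {rmorphism chain_alg n -> chain_alg n.+1};
  chain_widenZ : forall n, scalable (chain_widen n);
  chain_rel : forall n l r,
    YH_rel d a b c (@chain_braid n) (@chain_frame n) l r -> l = r;
  chain_ind : forall n (P : chain_alg n -> Prop),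
    P 1 -> (forall x u v, P u -> P v -> P (x *: u + v)) ->
    (forall i u, P u -> P (chain_braid i * u)) ->
    (forall j u, P u -> P (chain_frame j * u)) -> forall u, P u;
  chain_widen_braid : forall n (i : 'I_n.-1),
    chain_widen n (chain_braid i) =
    chain_braid (widen_ord (leq_pred n) i : 'I_n.+1.-1);
  chain_widen_frame : forall n (j : 'I_n),
    chain_widen n (chain_frame j) = chain_frame (widen_ord (leqnSn n) j)
}.

Arguments chain_rel {K d a b c} y {n} l r _.
Arguments chain_widenZ {K d a b c} y {n}.

Definition YH_concrete_chain (K : fieldType) (d : nat) (a b c : K) :
    YH_chain d a b c :=
  YHChain (fun n => @YH_widen_scalable K d n a b c)
    (fun n => @YH_gen_rel K d n a b c) (fun n => @YH_ind K d n a b c)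
    (fun n => @YH_widen_braid K d n a b c) (fun n => @YH_widen_frame K d n a b c).

(** * Extension of scalars along a field morphism *)

Section ScalarExtension.
Context (K L : fieldType) (d : nat) (a b c : K) (a' b' c' : L).
Context (Y : YH_chain d a b c) (Y' : YH_chain d a' b' c').
Context (sigma : {rmorphism K -> L}) (bc : forall n, {rmorphism Y n -> Y' n}).
Hypothesis bcZ : forall n x u, bc n (x *: u) = sigma x *: bc n u.
Hypothesis bc_braid : forall n i, bc n (chain_braid Y i) = chain_braid Y' i.
Hypothesis bc_frame : forall n j, bc n (chain_frame Y j) = chain_frame Y' j.

(** The image of [bc] spans the extended algebra: its span contains 1 and is stable under left
    multiplication by the generators, which are themselves images. *)
Lemma scalar_extension_ind n (P : Y' n -> Prop) :
  (forall x u v, P u -> P v -> P (x *: u + v)) ->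
  (forall u, P (bc n u)) -> forall u, P u.
Proof.
(* [span] is the linear span of the image, as an intersection of predicates. The induction on
   generators is run on it because [P] itself need not be stable under multiplication. *)
pose span := fun u => forall Q : Y' n -> Prop,
  (forall x v w, Q v -> Q w -> Q (x *: v + w)) -> (forall v, Q (bc n v)) -> Q u.
move=> Plin Pbc u; suff su : span u by exact (su P Plin Pbc).
have span_bc v : span (bc n v) by move=> Q _; apply.
have mul w v : span v -> span (bc n w * v).
  move=> sv Q Qlin Qbc; apply: (sv (fun v => Q (bc n w * v))) => [x v1 v2 Q1 Q2|v1].
    by rewrite mulrDr -scalerAr; exact: Qlin.
  by rewrite -rmorphM; exact: Qbc.
elim/(chain_ind (y := Y')): u => [|x u v su sv|i u|j u].
- by rewrite -(rmorph1 (bc n)); exact: span_bc.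
- by move=> Q Qlin Qbc; apply: (Qlin); [exact: su|exact: sv].
- by rewrite -bc_braid; exact: mul.
- by rewrite -bc_frame; exact: mul.
Qed.

Lemma scalar_extension_widen n u :
  bc n.+1 (chain_widen Y n u) = chain_widen Y' n (bc n u).
Proof.
elim/(chain_ind (y := Y)): u => [|x u v uE vE|i u uE|j u uE].
- by rewrite !rmorph1.
- by rewrite !rmorphD chain_widenZ !bcZ chain_widenZ uE vE.
- by rewrite !rmorphM chain_widen_braid !bc_braid chain_widen_braid uE.
- by rewrite !rmorphM chain_widen_frame !bc_frame chain_widen_frame uE.
Qed.

End ScalarExtension.

Section BaseChange.
Context (K : fieldType) (L : fieldExtType K) (d n : nat) (q : K).
Local Notation bc := (@Ytilde_base_change K L d q n).

Let f (y : strand_gen n) : Ytilde d (q%:A : L) n :=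
  match y with inl i => braid_gen i | inr j => frame_gen j end.
Let in_algE (x : K) :
  (in_alg (Ytilde d (q%:A : L) n) \o in_alg L) x = (in_alg L x)%:A.
Proof. by []. Qed.

Let base_change_rel (l r : Ytilde d (q%:A : L) n) :
  YH_rel d (in_alg L 1) (in_alg L (q - 1)) (in_alg L (q - 1))
    (f \o inl) (f \o inr) l r -> l = r.
Proof.
by rewrite /= scalerBl scale1r; exact: YH_gen_rel.
Qed.

Fact base_change_zmod : zmod_morphism bc.
Proof. exact: (alg_lift_zmod in_algE base_change_rel). Qed.
Fact base_change_monoid : monoid_morphism bc.
Proof. exact: (alg_lift_monoid in_algE base_change_rel). Qed.

HB.instance Definition _ := GRing.isZmodMorphism.Build _ _ bc base_change_zmod.
HB.instance Definition _ := GRing.isMonoidMorphism.Build _ _ bc base_change_monoid.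

Lemma base_change_braid i : bc (braid_gen i) = braid_gen i.
Proof. exact: (alg_lift_braid in_algE base_change_rel). Qed.
Lemma base_change_frame j : bc (frame_gen j) = frame_gen j.
Proof. exact: (alg_lift_frame in_algE base_change_rel). Qed.

Lemma base_changeZ (x : K) u : bc (x *: u) = (x%:A : L) *: bc u.
Proof. exact: (alg_liftZ in_algE base_change_rel). Qed.

End BaseChange.

(** * Traces *)

Section MarkovSpan.
Context (K : fieldType) (d : nat) (a b c : K) (Y : YH_chain d a b c).
Local Notation w x := (chain_widen Y _ x).
Local Notation G := (chain_braid Y).
Local Notation T := (chain_frame Y).

Lemma adj_swap_fixed n (i : 'I_n.-1) (j : 'I_n) :
  j != i :> nat -> j != i.+1 :> nat -> adj_swap i j = j.
Proof. by move=> ji ji1; rewrite /adj_swap tpermD // -val_eqE eq_sym. Qed.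

Lemma chain_widen_ind n (P : Y n.+1 -> Prop) :
  P 1 -> (forall x u v, P u -> P v -> P (x *: u + v)) ->
  (forall u v, P u -> P v -> P (u * v)) ->
  (forall i : 'I_n.-1, P (G (widen_ord (leq_pred n) i : 'I_n.+1.-1))) ->
  (forall j : 'I_n, P (T (widen_ord (leqnSn n) j))) ->
  forall u, P (w u).
Proof.
move=> P1 Plin Pmul PG PT; elim/chain_ind=> [|x u v uP vP|i u uP|j u uP].
- by rewrite rmorph1.
- by rewrite rmorphD chain_widenZ; exact: Plin.
- by rewrite rmorphM chain_widen_braid; exact: Pmul.
- by rewrite rmorphM chain_widen_frame; exact: Pmul.
Qed.

Lemma comm_lin (A : algType K) (z : A) x u v :
  GRing.comm z u -> GRing.comm z v -> GRing.comm z (x *: u + v).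
Proof.
by move=> zu zv; rewrite /GRing.comm mulrDl mulrDr -scalerAl -scalerAr zu zv.
Qed.

Lemma last_frame_widen n (u : Y n) : GRing.comm (T (ord_max : 'I_n.+1)) (w u).
Proof.
move: u; apply: chain_widen_ind => [|x u v||i|j].
- exact: commr1.
- exact: comm_lin.
- by move=> u v; exact: commrM.
- apply/commr_sym; rewrite /GRing.comm (braid_frame (chain_rel Y)).
  by rewrite adj_swap_fixed //=; have := ltn_ord i; lia.
- exact: (frame_comm (chain_rel Y)).
Qed.

(** The last braid generator moves only the two strands added by the widenings. *)
Lemma last_braid_widen2 n (u : Y n) :
  GRing.comm (G (ord_max : 'I_n.+2.-1)) (w (w u)).
Proof.
pose P v := GRing.comm (G (ord_max : 'I_n.+2.-1)) (w v).
apply: (chain_widen_ind (P := P)) => [|x v1 v2|v1 v2|i|j]; rewrite /P.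
- by rewrite rmorph1; exact: commr1.
- by rewrite rmorphD chain_widenZ; exact: comm_lin.
- by rewrite rmorphM; exact: commrM.
- rewrite chain_widen_braid; apply/commr_sym/chain_rel/YH_far => /=.
  by have := ltn_ord i; lia.
rewrite chain_widen_frame /GRing.comm (braid_frame (chain_rel Y)).
by rewrite adj_swap_fixed //=; have := ltn_ord j; lia.
Qed.

(** The condition [i.+1 = n] makes [i] the last braid generator of rank [n + 1]; for [n = 0] there
    is none and that constructor is void. *)
Inductive markov_span n : Y n.+1 -> Prop :=
| markov_span_lin x u v :
    markov_span u -> markov_span v -> markov_span (x *: u + v)
| markov_span_frame (u : Y n) k :
    markov_span (w u * T (ord_max : 'I_n.+1) ^+ k)
| markov_span_braid (i : 'I_n.+1.-1) (u v : Y n) of i.+1 = n :> nat :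
    markov_span (w u * G i * w v).

Lemma markov_span_widen n (u : Y n) : markov_span (w u).
Proof. by have := markov_span_frame u 0; rewrite expr0 mulr1. Qed.

Lemma markov_spanZ n x (u : Y n.+1) : markov_span u -> markov_span (x *: u).
Proof.
move=> su; rewrite -[x *: u]addr0; apply: markov_span_lin => //.
by rewrite -(rmorph0 (chain_widen Y n)); exact: markov_span_widen.
Qed.

Lemma markov_spanD n (u v : Y n.+1) :
  markov_span u -> markov_span v -> markov_span (u + v).
Proof. by rewrite -{2}[u]scale1r; exact: markov_span_lin. Qed.

Lemma markov_span_mul_widen n (x : Y n) u :
  markov_span u -> markov_span (w x * u).
Proof.
elim=> {u} [y u v _ IHu _ IHv|u k|i u v ni].
- by rewrite mulrDr -scalerAr; exact: markov_span_lin.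
- by rewrite mulrA -rmorphM; exact: markov_span_frame.
- by rewrite !mulrA -rmorphM; exact: markov_span_braid.
Qed.

(** In the braid case the last framing commutes with [w u], slides through the last braid generator,
    becomes a framing of lower rank and is absorbed into [w v]. *)
Lemma markov_span_mul_frame n u :
  markov_span u -> markov_span (T (ord_max : 'I_n.+1) * u).
Proof.
elim=> {u} [y u v _ IHu _ IHv|u k|i u v ni].
- by rewrite mulrDr -scalerAr; exact: markov_span_lin.
- by rewrite mulrA last_frame_widen -mulrA -exprS; exact: markov_span_frame.
rewrite !mulrA last_frame_widen -(mulrA (w u)).
have -> : ord_max = adj_swap i (lower i).
  by rewrite /adj_swap tpermL; apply: val_inj; rewrite /= ni.
rewrite -(braid_frame (chain_rel Y)).
have -> : lower i = widen_ord (leqnSn n) (i : 'I_n) by exact: val_inj.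
by rewrite -chain_widen_frame !mulrA -mulrA -rmorphM; exact: markov_span_braid.
Qed.

Lemma markov_span_mulX n (z : Y n.+1) k u :
  (forall v, markov_span v -> markov_span (z * v)) ->
  markov_span u -> markov_span (z ^+ k * u).
Proof.
move=> zP uP; elim: k => [|k IH]; first by rewrite expr0 mul1r.
by rewrite exprS -mulrA; exact: zP.
Qed.

Lemma markov_span_mul_idem n (x y : Y n.+1) u :
  (forall v, markov_span v -> markov_span (x * v)) ->
  (forall v, markov_span v -> markov_span (y * v)) ->
  markov_span u -> markov_span (frame_idem d x y * u).
Proof.
move=> xP yP uP; rewrite /frame_idem -scalerAl mulr_suml; apply: markov_spanZ.
elim/big_rec: _ => [|s v _ vP].
  by rewrite -(rmorph0 (chain_widen Y n)); exact: markov_span_widen.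
apply: markov_spanD vP; rewrite -mulrA.
by apply: markov_span_mulX => //; exact: markov_span_mulX.
Qed.

Section LastBraid.
Context (n : nat).
Local Notation g := (G (ord_max : 'I_n.+2.-1)).
Local Notation t := (T (ord_max : 'I_n.+2)).

Lemma lower_last : lower (ord_max : 'I_n.+2.-1) = widen_ord (leqnSn n.+1) ord_max.
Proof. exact: val_inj. Qed.

Lemma upper_last : upper (ord_max : 'I_n.+2.-1) = ord_max.
Proof. exact: val_inj. Qed.

Lemma last_braid_upper k : g * t ^+ k = w (T (ord_max : 'I_n.+1) ^+ k) * g.
Proof.
rewrite (braid_frameX (chain_rel Y)) rmorphXn chain_widen_frame.
by rewrite -lower_last -[in adj_swap _ _]upper_last /adj_swap tpermR.
Qed.

Lemma last_braid_lower k : g * w (T (ord_max : 'I_n.+1) ^+ k) = t ^+ k * g.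
Proof.
rewrite rmorphXn chain_widen_frame -lower_last.
rewrite (braid_frameX (chain_rel Y)).
by rewrite /adj_swap tpermL upper_last.
Qed.

Lemma last_braid_quad :
  g ^+ 2 = a%:A + b *: frame_idem d (w (T (ord_max : 'I_n.+1))) t
    + c *: (frame_idem d (w (T (ord_max : 'I_n.+1))) t * g).
Proof.
rewrite (braid_quad (chain_rel Y)) chain_widen_frame.
by rewrite lower_last upper_last.
Qed.

End LastBraid.

(** Induction on the rank. The span contains 1 and must be stable under left multiplication by
    generators; those of lower rank and the last framing are settled above, which leaves the last
    braid generator. *)
Lemma markov_spanP n u : @markov_span n u.
Proof.
elim: n u => [|n IH].
  elim/chain_ind=> [|x u v|i|j u].
  - by rewrite -(rmorph1 (chain_widen Y 0)); exact: markov_span_widen.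
  - exact: markov_span_lin.
  - by case: i.
  rewrite (ord1 j) (_ : 0 = ord_max); last exact: val_inj.
  exact: markov_span_mul_frame.
set g := G (ord_max : 'I_n.+2.-1).
have spanG (u v : Y n.+1) : markov_span (w u * g * w v).
  exact: markov_span_braid.
have mulG u : markov_span u -> markov_span (g * u).
  elim=> {u} [y u v _ IHu _ IHv|u k|i u v ni].
  - by rewrite mulrDr -scalerAr; exact: markov_span_lin.
  (* The framing power is first moved next to [g], through which it slides to the lower rank. *)
  - rewrite -(commr_sym (commrX k (commr_sym (last_frame_widen u)))) mulrA.
    by rewrite last_braid_upper.
  have -> : i = ord_max by apply: val_inj; case: ni.
  (* In [g * w u * g * w v] the middle factor [u] is expanded along the spanning family of the lower
     rank. *)
  rewrite -/g !mulrA; elim: (IH u) => {u} [y u u' _ IHu _ IHu'|u k|j u u' nj].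
  - rewrite rmorphD chain_widenZ mulrDr !mulrDl -scalerAr -!scalerAl.
    exact: markov_span_lin.
  (* The middle factor ends in a framing power: [g] passes the rest, turns that framing into the
     last one, and the resulting [g ^+ 2] is reduced by the quadratic relation. *)
  - rewrite rmorphM mulrA last_braid_widen2 -(mulrA (w (w u)) g) last_braid_lower -!mulrA.
    apply: markov_span_mul_widen; apply: markov_span_mulX.
      exact: markov_span_mul_frame.
    rewrite mulrA -expr2 last_braid_quad.
    have := @markov_span_mul_idem _ (w (T (ord_max : 'I_n.+1))) (T ord_max) _
      (@markov_span_mul_widen _ _) (@markov_span_mul_frame _).
    move: (frame_idem d _ _) => e mule; rewrite !mulrDl -!scalerAl mul1r.
    apply: markov_spanD; [apply: markov_spanD|]; apply: markov_spanZ.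
    + exact: markov_span_widen.
    + exact/mule/markov_span_widen.
    rewrite -mulrA; apply: mule; have := spanG 1 v.
    by rewrite rmorph1 mul1r.
  (* The middle factor contains the previous braid generator: the braid relation leaves a single
     [g]. *)
  have gg : g * w (G j) * g = w (G j) * g * w (G j).
    by rewrite chain_widen_braid; apply/esym/chain_rel/YH_braid; rewrite /= nj.
  rewrite !rmorphM !mulrA last_braid_widen2 -(mulrA _ (w (w u'))).
  rewrite -(last_braid_widen2 u') !mulrA -2!(mulrA (w (w u))) gg.
  by rewrite !mulrA -rmorphM -!mulrA -!rmorphM !mulrA.
elim/chain_ind=> [|x u v|i u uP|j u uP].
- by rewrite -(rmorph1 (chain_widen Y n.+1)); exact: markov_span_widen.
- exact: markov_span_lin.
- have [ni|ni] := eqVneq (i : nat) n.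
    by rewrite (_ : i = ord_max); [exact: mulG|exact: val_inj].
  have ni' : (i < n)%N by have := ltn_ord i; rewrite /= in ni *; lia.
  have -> : i = widen_ord (leq_pred n.+1) (Ordinal ni' : 'I_n.+1.-1).
    exact: val_inj.
  by rewrite -chain_widen_braid; exact: markov_span_mul_widen.
have [nj|nj] := eqVneq (j : nat) n.+1.
  by rewrite (_ : j = ord_max); [exact: markov_span_mul_frame|exact: val_inj].
have nj' : (j < n.+1)%N by have := ltn_ord j; lia.
have -> : j = widen_ord (leqnSn n.+1) (Ordinal nj') by exact: val_inj.
by rewrite -chain_widen_frame; exact: markov_span_mul_widen.
Qed.

End MarkovSpan.

Section ScalarForms.
Context (K : fieldType) (V : lmodType K) (f : V -> K).
Hypothesis f_lin : scalar f.

Lemma scalar_formD u v : f (u + v) = f u + f v.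
Proof. by rewrite -[in LHS](scale1r u) f_lin mul1r. Qed.

Lemma scalar_form0 : f 0 = 0.
Proof. by apply: (addrI (f 0)); rewrite -scalar_formD !addr0. Qed.

Lemma scalar_formZ x u : f (x *: u) = x * f u.
Proof. by rewrite -[x *: u]addr0 f_lin scalar_form0 addr0. Qed.

Lemma scalar_form_sum I (r : seq I) (P : pred I) (F : I -> V) :
  f (\sum_(i <- r | P i) F i) = \sum_(i <- r | P i) f (F i).
Proof. by elim/big_rec2: _ => [|i x u _ <-]; rewrite ?scalar_form0 ?scalar_formD. Qed.

End ScalarForms.

Record chain_trace (K : fieldType) (d : nat) (a b c : K) (Y : YH_chain d a b c)
    (z : K) (cst : nat -> K) (tr : forall n, Y n -> K) : Prop := ChainTrace {
  trace_linear : forall n, scalar (tr n);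
  trace_cyclic : forall n (x y : Y n.+1), tr n.+1 (x * y) = tr n.+1 (y * x);
  trace_braid : forall n (x : Y n.+1),
    tr n.+2 (chain_widen Y n.+1 x * chain_braid Y (ord_max : 'I_n.+2.-1)) =
    z * tr n.+1 x;
  trace_frame : forall n (x : Y n) k, (k < d)%N ->
    tr n.+1 (chain_widen Y n x * chain_frame Y ord_max ^+ k) = cst k * tr n x
}.

(** * Extension of a trace to a larger field *)

Section TraceExtension.
Context (K L : fieldType) (d : nat) (a b c : K) (a' b' c' : L).
Context (Y : YH_chain d a b c) (Y' : YH_chain d a' b' c').
Context (sigma : {rmorphism K -> L}) (bc : forall n, {rmorphism Y n -> Y' n}).
Hypothesis bcZ : forall n x u, bc n (x *: u) = sigma x *: bc n u.
Hypothesis bc_braid : forall n i, bc n (chain_braid Y i) = chain_braid Y' i.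
Hypothesis bc_frame : forall n j, bc n (chain_frame Y j) = chain_frame Y' j.
Context (z : K) (cst : nat -> K).
Context (tr : forall n, Y n -> K) (tr' : forall n, Y' n -> L).
Arguments tr' {n}.
Hypothesis tr_trace : chain_trace z cst tr.
Hypothesis tr'_lin : forall n, scalar (@tr' n).
Hypothesis tr'_bc : forall n x, tr' (bc n x) = sigma (tr x).

Local Notation ind := (scalar_extension_ind bc_braid bc_frame).
Local Notation widenE := (scalar_extension_widen bcZ bc_braid bc_frame).

(** Each identity is linear over [L] in every argument, so it is checked on images of [bc], where it
    is the image under [sigma] of the identity for [tr]. *)
Lemma trace_extension : chain_trace (sigma z) (sigma \o cst) (@tr').
Proof.
split=> // n.
- move=> x y; move: x; apply: ind => [k u v uy vy|u].
    by rewrite mulrDl mulrDr -scalerAl -scalerAr !tr'_lin uy vy.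
  move: y; apply: ind => [k x y ux uy|x].
    by rewrite mulrDl mulrDr -scalerAl -scalerAr !tr'_lin ux uy.
  by rewrite -!rmorphM !tr'_bc (trace_cyclic tr_trace).
- apply: ind => [k x y IHx IHy|x].
    rewrite rmorphD chain_widenZ mulrDl -scalerAl !tr'_lin IHx IHy.
    by rewrite mulrDr mulrCA.
  rewrite -widenE -bc_braid -rmorphM !tr'_bc (trace_braid tr_trace).
  exact: rmorphM.
move=> y k kd; move: y; apply: ind => [l x y IHx IHy|x].
  rewrite rmorphD chain_widenZ mulrDl -scalerAl !tr'_lin IHx IHy.
  by rewrite mulrDr mulrCA.
rewrite -widenE -bc_frame -rmorphXn -rmorphM !tr'_bc (trace_frame tr_trace) //.
exact: rmorphM.
Qed.

End TraceExtension.

(** * Trace values on the last idempotent *)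

Section MarkovTrace.
Context (K : fieldType) (d : nat) (a b c : K) (Y : YH_chain d a b c).
Context (z E : K) (cst : nat -> K) (tr : forall n, Y n -> K).
Arguments tr {n}.
Hypothesis tr_trace : chain_trace z cst (@tr).
Hypothesis d_neq0 : d%:R != 0 :> K.
Hypothesis cst_period : forall k, cst (k + d) = cst k.
Hypothesis cst_conv : forall k,
  d%:R^-1 * \sum_(0 <= s < d) cst (d - s) * cst (k + s) = E * cst k.

Local Notation w x := (chain_widen Y _ x).
Local Notation G := (chain_braid Y).
Local Notation T := (chain_frame Y).
Local Notation Tlast n := (T (ord_max : 'I_n.+1)).

Let tr_lin n : scalar (@tr n) := trace_linear tr_trace (n := n).

Let d_gt0 : (0 < d)%N.
Proof. by case: d d_neq0 => //; rewrite eqxx. Qed.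

(** Both sides depend on [k] only modulo [d], which reduces to exponents below [d]. *)
Lemma trace_frame_power n (x : Y n) k : tr (w x * Tlast n ^+ k) = cst k * tr x.
Proof.
have cE : cst k = cst (k %% d).
  rewrite {1}(divn_eq k d) addnC; elim: (k %/ d)%N => [|m IH]; first by rewrite addn0.
  by rewrite mulSn addnCA addnC cst_period.
have tE : Tlast n ^+ k = Tlast n ^+ (k %% d).
  rewrite {1}(divn_eq k d) exprD mulnC exprM.
  by rewrite (frame_order (chain_rel Y)) expr1n mul1r.
by rewrite cE tE (trace_frame tr_trace) // ltn_mod.
Qed.

(* On a power of the last framing, [cst_conv] says that multiplying by this element
   multiplies the trace by E; [trace_average] extends this to all elements. *)
Definition frame_average n : Y n.+1 :=
  d%:R^-1 *: \sum_(0 <= s < d) cst (d - s) *: Tlast n ^+ s.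

Lemma trace_mul_average n (y : Y n.+1) :
  tr (y * frame_average n) =
  d%:R^-1 * \sum_(0 <= s < d) cst (d - s) * tr (y * Tlast n ^+ s).
Proof.
rewrite /frame_average -scalerAr (scalar_formZ (@tr_lin _)) mulr_sumr.
rewrite (scalar_form_sum (@tr_lin _)); congr (_ * _); apply: eq_bigr => s _.
by rewrite -scalerAr (scalar_formZ (@tr_lin _)).
Qed.

(** Induction on the rank and along the spanning family. For a product [w u * G * w v] the average
    passes [w v] and slides through [G] to the average of lower rank; cyclicity brings [G] to the
    end, and both sides become [z] times traces of lower rank. *)
Lemma trace_average n (y : Y n.+1) : tr (y * frame_average n) = E * tr y.
Proof.
elim: n y => [|n IH] y.
all: elim: (markov_spanP y) => {y} [x u v _ uE _ vE|u k|i u v ni].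
all: try by rewrite mulrDl -scalerAl !(@tr_lin _) uE vE mulrDr mulrCA.
all: try (rewrite trace_frame_power mulrA -cst_conv trace_mul_average -mulrA mulr_suml;
  by congr (_ * _); apply: eq_bigr => s _;
  rewrite -mulrA -exprD trace_frame_power mulrA).
  by case: i ni.
have -> : i = ord_max by apply: val_inj; case: ni.
have avgC : GRing.comm (w v) (frame_average n.+1).
  rewrite /frame_average /GRing.comm -scalerAr -scalerAl; congr (_ *: _).
  apply: commr_sum => s _; rewrite /GRing.comm -scalerAr -scalerAl; congr (_ *: _).
  exact/commrX/commr_sym/last_frame_widen.
have avgG : G (ord_max : 'I_n.+2.-1) * frame_average n.+1 =
    w (frame_average n) * G (ord_max : 'I_n.+2.-1).
  rewrite /frame_average chain_widenZ rmorph_sum -scalerAr -scalerAl.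
  congr (_ *: _); rewrite mulr_sumr mulr_suml; apply: eq_bigr => s _.
  by rewrite chain_widenZ -scalerAr -scalerAl last_braid_upper.
rewrite -mulrA avgC !mulrA -(mulrA (w u)) avgG mulrA.
rewrite (trace_cyclic tr_trace) [in RHS](trace_cyclic tr_trace) !mulrA -!rmorphM.
by rewrite !(trace_braid tr_trace) IH mulrCA.
Qed.

(** Evaluating the last framing in each term of the idempotent produces the coefficients of
    [frame_average]. *)
Lemma trace_last_idem n (y : Y n.+1) :
  tr (w y * frame_idem d (w (Tlast n)) (Tlast n.+1)) = E * tr y.
Proof.
rewrite -trace_average trace_mul_average /frame_idem -scalerAr (scalar_formZ (@tr_lin _)).
rewrite mulr_sumr (scalar_form_sum (@tr_lin _)); congr (_ * _); apply: eq_bigr => s _.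
by rewrite mulrA -rmorphXn -rmorphM trace_frame_power.
Qed.

(** Each of the [d] terms contributes [z * tr y]: the power of the last framing slides through the
    braid generator and goes around the trace, and once the generator is evaluated the two powers of
    the same framing multiply to its [d]-th power, 1. *)
Lemma trace_last_idem_braid n (y : Y n.+1) :
  tr (w y * (frame_idem d (w (Tlast n)) (Tlast n.+1) * G (ord_max : 'I_n.+2.-1)))
  = z * tr y.
Proof.
rewrite /frame_idem -scalerAl -scalerAr (scalar_formZ (@tr_lin _)).
rewrite mulr_suml mulr_sumr (scalar_form_sum (@tr_lin _)).
rewrite (eq_big_nat _ _ (F2 := fun=> z * tr y)) => [|s /andP[_ sd]].
  by rewrite sumr_const_nat subn0 -(mulr_natl (z * tr y)) mulKf.
rewrite -(mulrA (_ ^+ s)) -last_braid_lower -rmorphXn !mulrA -rmorphM.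
rewrite (trace_cyclic tr_trace) mulrA -rmorphM (trace_braid tr_trace).
rewrite (trace_cyclic tr_trace) -mulrA -exprD addnC subnK ?(ltnW sd) //.
by rewrite (frame_order (chain_rel Y)) mulr1.
Qed.

End MarkovTrace.

(** * Change of generators *)

Lemma rinv_unique (A : nzRingType) (x y : A) : x * y = 1 -> y * x = 1 -> rinv x = y.
Proof.
move=> xy yx; have [xV _] := rinvP (ex_intro _ y (conj xy yx)).
by rewrite -[rinv x]mul1r -yx -mulrA xV mulr1.
Qed.

Lemma rinv_morph (A B : nzRingType) (phi : {rmorphism A -> B}) (x : A) :
  (exists y, x * y = 1 /\ y * x = 1) -> phi (rinv x) = rinv (phi x).
Proof.
move=> xV; have [xrV rVx] := rinvP xV.
by apply/esym/rinv_unique; rewrite -rmorphM ?xrV ?rVx rmorph1.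
Qed.

(** Inverse letters are evaluated by [rinv], which a morphism is known to respect only at invertible
    elements; hence the first hypothesis. *)
Lemma group_eval_morph (X : choiceType) (rel : word X -> word X -> Prop)
    (A B : nzRingType) (phi : {rmorphism A -> B}) (f : X -> A) (f' : X -> B) :
  (forall x, exists y, f x * y = 1 /\ y * f x = 1) ->
  (forall x, phi (f x) = f' x) ->
  forall b : presented_group rel, phi (group_eval f b) = group_eval f' b.
Proof.
move=> fV ff' b; rewrite /group_eval rmorph_prod; apply: eq_bigr => -[x e] _.
by rewrite /letter_eval /=; case: e; rewrite ?rinv_morph ?ff'.
Qed.

Section Twist.
Context (K : fieldType) (A : algType K) (e : A).
Hypothesis ee : e * e = e.
Local Notation f x := (x%:A + (1 - x) *: e).

Lemma twist_mul_idem (x : K) : f x * e = e.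
Proof. by rewrite mulrDl -!scalerAl mul1r ee -scalerDl addrC subrK scale1r. Qed.

(** [f x] is [x] on the component of [1 - e] and 1 on that of [e], and these components multiply
    separately. *)
Lemma twist_mul (x y : K) : f x * f y = f (x * y).
Proof.
rewrite mulrDr -!scalerAr mulr1 twist_mul_idem scalerDr !scalerA -addrA -scalerDl.
by rewrite [y * x]mulrC; congr (_ + _ *: _); ring.
Qed.

Lemma twist1 : f (1 : K) = 1.
Proof. by rewrite subrr scale0r addr0 scale1r. Qed.

(** Since [f r] commutes with [g], the square is [s ^+ 2] times [f q * g ^+ 2], and every twist
    fixes [e]. *)
Lemma twisted_quad (q r s : K) (g : A) :
  q = r ^+ 2 -> GRing.comm g e ->
  g ^+ 2 = 1%:A + (q - 1) *: e + (q - 1) *: (e * g) ->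
  (s *: (f r * g)) ^+ 2 =
  ((r * s) ^+ 2)%:A + 0 *: e + ((q - 1) * s) *: (e * (s *: (f r * g))).
Proof.
move=> qr ge quad.
have ef x : e * f x = e.
  by rewrite mulrDr -!scalerAr mulr1 ee -scalerDl addrC subrK scale1r.
have gf : g * f r = f r * g.
  by rewrite mulrDl mulrDr -!scalerAl -!scalerAr ge mul1r mulr1.
have -> : (s *: (f r * g)) ^+ 2 = (s * s) *: (f (r * r) * g ^+ 2).
  rewrite expr2 -scalerAl -scalerAr scalerA -twist_mul expr2; congr (_ *: _).
  by rewrite -!mulrA; congr (_ * _); rewrite !mulrA gf.
rewrite quad -[r * r]expr2 -qr; have fe := twist_mul_idem q.
rewrite -[e * (s *: _)]scalerAr [e * (f r * g)]mulrA ef scale0r addr0.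
rewrite 2!mulrDr -!scalerAr mulr1 mulrA fe scale1r.
(* The multiple of [e] in [f q] cancels the one in the old relation, so the new relation has no bare
   [e] term. *)
have -> : (q%:A + (1 - q) *: e + (q - 1) *: e : A) = q%:A.
  by rewrite -addrA -scalerDl addrA subrK subrr scale0r addr0.
by rewrite scalerDr !scalerA exprMn -qr expr2; congr (_ *: _ + _ *: _); ring.
Qed.

End Twist.

(** The braid and framing relations survive any twist [al%:A + be *: e]. The quadratic one relies on
    the form [r%:A + (1 - r) *: e] and fixes the parameters [u = r * s] and [v = (q - 1) * s]. *)
Lemma twisted_YH_rel (K : fieldType) (d n : nat) (q r s : K) (A : algType K)
    (g : 'I_n.-1 -> A) (t : 'I_n -> A) :
  q = r ^+ 2 ->
  (forall x y, YH_rel d 1 (q - 1) (q - 1) g t x y -> x = y) ->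
  let e i := frame_idem d (t (lower i)) (t (upper i)) in
  let h i := s *: ((r%:A + (1 - r) *: e i) * g i) in
  forall x y, YH_rel d ((r * s) ^+ 2) 0 ((q - 1) * s) h t x y -> x = y.
Proof.
move=> qr gt_rel e h x y; case=> [i j ij|i j ij|i j|i j|j|i]; rewrite ?/h.
- rewrite -!scalerAl -!scalerAr; do 2!congr (_ *: _).
  exact: (twisted_far gt_rel).
- rewrite -!scalerAl -!scalerAr -!scalerAl; do 3!congr (_ *: _).
  exact: (twisted_braid gt_rel).
- exact: (frame_comm gt_rel).
- by rewrite -scalerAl -scalerAr (twisted_slide gt_rel).
- exact: (frame_order gt_rel).
apply: twisted_quad => //; first exact: (idem_idem gt_rel).
  exact: (braid_idem_comm gt_rel).
exact: (braid_quad gt_rel).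
Qed.

Lemma map_twist (K : fieldType) (A B : algType K) (phi : {rmorphism A -> B})
    (x y : K) (e : A) :
  scalable phi -> phi (x%:A + y *: e) = x%:A + y *: phi e.
Proof. by move=> phiZ; rewrite rmorphD !phiZ rmorph1. Qed.

Section InverseGenerators.
Context (K : fieldType) (d n : nat) (u v : K) (A : algType K).
Context (g : 'I_n.-1 -> A) (t : 'I_n -> A).
Hypothesis gt_rel : forall x y, YH_rel d (u ^+ 2) 0 v g t x y -> x = y.
Local Notation e i := (frame_idem d (t (lower i)) (t (upper i))).

Lemma frame_unit j : (0 < d)%N -> exists y, t j * y = 1 /\ y * t j = 1.
Proof.
move=> d_gt0; exists (t j ^+ d.-1).
by rewrite -exprS -exprSr prednK // (frame_order gt_rel).
Qed.

Hypothesis u_neq0 : u != 0.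

(** The quadratic relation reads [g (g - v e) = u ^+ 2], and [e] commutes with [g]. *)
Lemma braid_mulV i :
  let y := u ^- 2 *: (g i - v *: e i) in g i * y = 1 /\ y * g i = 1.
Proof.
have ge := braid_idem_comm gt_rel i; have quad := braid_quad gt_rel i.
move: (e i) ge quad => E ge quad /=.
have uV : u ^- 2 * u ^+ 2 = 1 by rewrite mulVf ?expf_neq0.
rewrite -scalerAr -scalerAl mulrBl mulrBr -scalerAl -scalerAr -expr2 quad ge.
by rewrite scale0r addr0 addrK scalerA uV scale1r.
Qed.

Lemma twisted_braid_unit (x : K) i : x != 0 ->
  exists y, (x%:A + (1 - x) *: e i) * g i * y = 1 /\
            y * ((x%:A + (1 - x) *: e i) * g i) = 1.
Proof.
move=> x0; have [gV Vg] := braid_mulV i.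
have ee := idem_idem gt_rel (lower i) (upper i).
move: (e i) ee gV Vg => E ee; set y := _ *: _ => gV Vg.
exists (y * (x^-1%:A + (1 - x^-1) *: E)); split.
  by rewrite mulrA -(mulrA _ (g i)) gV mulr1 twist_mul // mulfV // twist1.
rewrite mulrA -(mulrA y) twist_mul // mulVf // twist1 mulr1.
exact: Vg.
Qed.

End InverseGenerators.

(** * The identification of the two presentations and the Markov properties *)

Section Identification.
Context (K : fieldType) (d : nat) (q r s : K).
Context (Yt : YH_chain d 1 (q - 1) (q - 1)).
Context (Yg : YH_chain d ((r * s) ^+ 2) 0 ((q - 1) * s)).
Context (phi : forall n, {rmorphism Yg n -> Yt n}).
Arguments phi {n}.
Local Notation e i :=
  (frame_idem d (chain_frame Yt (lower i)) (chain_frame Yt (upper i))).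
Hypothesis phiZ : forall n, scalable (@phi n).
Hypothesis phi_braid : forall n (i : 'I_n.-1),
  phi (chain_braid Yg i) = s *: ((r%:A + (1 - r) *: e i) * chain_braid Yt i).
Hypothesis phi_frame : forall n (j : 'I_n),
  phi (chain_frame Yg j) = chain_frame Yt j.

Lemma identification_widen n (x : Yg n) :
  phi (chain_widen Yg n x) = chain_widen Yt n (phi x).
Proof.
elim/(chain_ind (y := Yg)): x => [|k x y xE yE|i x xE|j x xE].
- by rewrite !rmorph1.
- by rewrite !rmorphD chain_widenZ !phiZ chain_widenZ xE yE.
- rewrite !rmorphM xE chain_widen_braid !phi_braid; congr (_ * _).
  rewrite chain_widenZ rmorphM (map_twist _ _ _ (chain_widenZ Yt)).
  rewrite (map_frame_idem (chain_widenZ Yt _)) !chain_widen_frame chain_widen_braid.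
  congr (_ *: _); congr ((_ + _ *: _) * _).
  by congr (frame_idem _ (chain_frame Yt _) (chain_frame Yt _)); exact: val_inj.
by rewrite !rmorphM xE chain_widen_frame !phi_frame chain_widen_frame.
Qed.

Hypothesis r_neq0 : r != 0.
Hypothesis s_neq0 : s != 0.
Hypothesis q_r : q = r ^+ 2.

Lemma identification_gamma n (b : framed_braid_group d n) : (0 < d)%N ->
  phi (group_eval (fun y => match y with
    | inl i => (r^-1%:A + (1 - r^-1) *:
        frame_idem d (chain_frame Yg (lower i)) (chain_frame Yg (upper i)))
        * chain_braid Yg i
    | inr j => chain_frame Yg j
    end) b) =
  group_eval (fun y => match y with
    | inl i => s *: chain_braid Yt i
    | inr j => chain_frame Yt j
    end) b.
Proof.
(* The images of the letters are shown invertible first, for the sake of inverse letters, and then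
   compared. *)
move=> d_gt0; apply: group_eval_morph => [[i|j]|[i|j]].
- apply: (twisted_braid_unit (chain_rel Yg)).
    by rewrite mulf_neq0.
  by rewrite invr_neq0.
- exact: (frame_unit (chain_rel Yg)).
- rewrite rmorphM (map_twist _ _ _ (@phiZ _)) (map_frame_idem (@phiZ _ _)).
  rewrite !phi_frame phi_braid -scalerAr mulrA; congr (_ *: _).
  rewrite twist_mul; last exact: (idem_idem (chain_rel Yt)).
  by rewrite mulVf // twist1 mul1r.
exact: phi_frame.
Qed.

Context (z E : K) (cst : nat -> K) (tr : forall n, Yt n -> K).
Arguments tr {n}.
Hypothesis tr_trace : chain_trace z cst (@tr).
Hypothesis d_neq0 : d%:R != 0 :> K.
Hypothesis cst_period : forall k, cst (k + d) = cst k.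
Hypothesis cst_conv : forall k,
  d%:R^-1 * \sum_(0 <= l < d) cst (d - l) * cst (k + l) = E * cst k.
Hypothesis z_neq0 : z != 0.
Hypothesis s_sqr : s ^+ 2 = (z + (1 - q) * E) / (q * z).

Local Notation D := (s * z)^-1.
Definition chain_rho n (x : Yg n) : K := D ^+ n.-1 * tr (phi x).

Let tr_lin n : scalar (@tr n) := trace_linear tr_trace (n := n).

Lemma chain_rho_linear n : scalar (@chain_rho n).
Proof.
by move=> k x y; rewrite /chain_rho rmorphD phiZ (@tr_lin _) mulrDr mulrCA.
Qed.

Lemma chain_rho_cyclic n (x y : Yg n.+1) : chain_rho (x * y) = chain_rho (y * x).
Proof. by rewrite /chain_rho !rmorphM (trace_cyclic tr_trace). Qed.

Let last_idemE n :
  e (ord_max : 'I_n.+2.-1) = frame_idem d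
    (chain_widen Yt _ (chain_frame Yt (ord_max : 'I_n.+1))) (chain_frame Yt ord_max).
Proof. by rewrite chain_widen_frame lower_last upper_last. Qed.

(** [G] and [e * G] have the same trace factor [z], so the weights [r] and [1 - r] of the twist add
    up to 1. *)
Let trace_braid_image n (y : Yt n.+1) :
  tr (chain_widen Yt _ y * phi (chain_braid Yg (ord_max : 'I_n.+2.-1))) =
  s * z * tr y.
Proof.
have := trace_last_idem_braid tr_trace d_neq0 y; have := trace_braid tr_trace y.
rewrite phi_braid last_idemE; move: (frame_idem d _ _) => f trG trfG.
rewrite mulrDl -!scalerAl mul1r -scalerAr mulrDr -!scalerAr (scalar_formZ (@tr_lin _)).
rewrite (scalar_formD (@tr_lin _)) !(scalar_formZ (@tr_lin _)) trG trfG; ring.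
Qed.

(** One more strand brings one more factor [D], the inverse of the trace factor [s * z]. *)
Lemma chain_rho_braid n (x : Yg n.+1) :
  chain_rho (chain_widen Yg _ x * chain_braid Yg (ord_max : 'I_n.+2.-1)) =
  chain_rho x.
Proof.
rewrite /chain_rho rmorphM identification_widen trace_braid_image /= mulrA.
by rewrite exprSr divfK // mulf_neq0.
Qed.

Lemma chain_rho_braidV n (x : Yg n.+1) :
  chain_rho (chain_widen Yg _ x * rinv (chain_braid Yg (ord_max : 'I_n.+2.-1))) =
  chain_rho x.
Proof.
have rs0 : r * s != 0 by rewrite mulf_neq0.
have [gV Vg] := braid_mulV (chain_rel Yg) rs0 (ord_max : 'I_n.+2.-1).
rewrite /chain_rho (rinv_unique gV Vg) rmorphM identification_widen.
rewrite phiZ rmorphB phiZ (map_frame_idem (@phiZ _ _)) !phi_frame last_idemE.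
have := trace_last_idem tr_trace d_neq0 cst_period cst_conv (phi x).
move: (frame_idem d _ _) => f trf.
rewrite -scalerAr (scalar_formZ (@tr_lin _)) -scaleN1r mulrDr -!scalerAr.
rewrite (scalar_formD (@tr_lin _)) !(scalar_formZ (@tr_lin _)) trf trace_braid_image /=.
have q0 : q != 0 by rewrite q_r expf_neq0.
have lam : z + (1 - q) * E = q * s ^+ 2 * z by rewrite s_sqr; field; rewrite q0 z_neq0.
move: (tr (phi x)) => y; rewrite (exprMn _ r s) -q_r.
(* The trace factor of the inverse is that of [g] times [q * s ^+ 2], which the prefactor [u ^- 2]
   cancels. *)
have -> : s * z * y + -1 * ((q - 1) * s * (E * y)) = q * s ^+ 2 * (s * z * y).
  transitivity (s * y * (z + (1 - q) * E)); first by ring.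
  by rewrite lam; ring.
by rewrite mulKf ?mulf_neq0 ?expf_neq0 // mulrA exprSr divfK // mulf_neq0.
Qed.

End Identification.

(** * The concrete algebras *)

Section TwistMap.
Context (K : fieldType) (d n : nat) (q r s : K).
Hypothesis q_r : q = r ^+ 2.
Local Notation A := (YH d n ((r * s) ^+ 2) 0 ((q - 1) * s)).
Local Notation B := (YH d n 1 (q - 1) (q - 1)).

Let f (y : strand_gen n) : B := match y with
  | inl i => s *: ((r%:A + (1 - r) *: idem_gen i) * braid_gen i)
  | inr j => frame_gen j
  end.

(** Convertible to [identification] when [r] is [sqrtqS] and [s] is [sl]; the parameters are left
    abstract here. *)
Definition twist_map (x : A) : B := YH_lift (in_alg B) f x.

Let in_algE (x : K) : in_alg B x = (idfun x)%:A. Proof. by []. Qed.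

Let f_rel := twisted_YH_rel (s := s) q_r (@YH_gen_rel K d n 1 (q - 1) (q - 1)).

Lemma twist_map_zmod : zmod_morphism twist_map.
Proof. exact: (alg_lift_zmod in_algE f_rel). Qed.
Lemma twist_map_monoid : monoid_morphism twist_map.
Proof. exact: (alg_lift_monoid in_algE f_rel). Qed.
Lemma twist_mapZ : scalable twist_map.
Proof. exact: (alg_liftZ in_algE f_rel). Qed.
Lemma twist_map_braid i :
  twist_map (braid_gen i) = s *: ((r%:A + (1 - r) *: idem_gen i) * braid_gen i).
Proof. exact: (alg_lift_braid in_algE f_rel). Qed.
Lemma twist_map_frame j : twist_map (frame_gen j) = frame_gen j.
Proof. exact: (alg_lift_frame in_algE f_rel). Qed.

Definition twist_morphism : {rmorphism A -> B} := HB.pack twist_map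
  (GRing.isZmodMorphism.Build _ _ _ twist_map_zmod)
  (GRing.isMonoidMorphism.Build _ _ _ twist_map_monoid).

End TwistMap.

(** * The moments of a set of roots of unity *)

Section RootMeans.
Context (R : realType) (d : nat) (xi : 'I_d -> R[i]) (S : {set 'I_d}).
Hypothesis d_gt0 : (0 < d)%N.
Hypothesis xi_inj : injective xi.
Hypothesis xi_order : forall i, xi i ^+ d = 1.

Lemma root_mean_period k : root_mean S xi (k + d) = root_mean S xi k.
Proof.
rewrite /root_mean; congr (_ * _); apply: eq_bigr => i _.
by rewrite exprD xi_order mulr1.
Qed.

(** This is a geometric sum with ratio [xi j / xi i], a [d]-th root of unity that differs from 1 for
    [i != j] by injectivity of [xi]. *)
Lemma roots_orthogonal i j :
  \sum_(0 <= s < d) xi i ^+ (d - s) * xi j ^+ s = (i == j)%:R * d%:R.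
Proof.
have xi_unit i' : xi i' \is a GRing.unit.
  apply: contraT; rewrite unitfE negbK => /eqP xi0; move: (xi_order i').
  by rewrite xi0 expr0n gtn_eqF // => /esym/eqP; rewrite oner_eq0.
rewrite (eq_big_nat _ _ (F2 := fun s => (xi j / xi i) ^+ s)) => [|s /andP[_ sd]].
  have [->|ij] := eqVneq i j.
    under eq_bigr do rewrite divrr // expr1n.
    by rewrite sumr_const_nat subn0 mul1r.
  rewrite big_mkord mul0r; apply/eqP.
  have : (xi j / xi i - 1) * \sum_(s < d) (xi j / xi i) ^+ s == 0.
    by rewrite -subrX1 expr_div_n !xi_order divr1 subrr.
  rewrite mulf_eq0 subr_eq0 => /orP[/eqP xij|//].
  by case/eqP: ij; apply: xi_inj; rewrite -[LHS]mul1r -xij divrK.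
by rewrite expr_div_n exprB ?xi_order ?div1r 1?mulrC // ltnW.
Qed.

(** Expanding both means gives a double sum over [S], of which orthogonality keeps [d] times the
    diagonal; one of the two factors [N^-1] remains. *)
Lemma root_mean_conv k : S != finset.set0 ->
  d%:R^-1 * \sum_(0 <= s < d) root_mean S xi (d - s) * root_mean S xi (k + s) =
  #|S|%:R^-1 * root_mean S xi k.
Proof.
move=> S0; have dN0 : d%:R != 0 :> R[i] by rewrite pnatr_eq0 -lt0n.
rewrite /root_mean; set N := #|S|%:R.
have -> : \sum_(0 <= s < d) N^-1 * (\sum_(i in S) xi i ^+ (d - s)) *
    (N^-1 * (\sum_(j in S) xi j ^+ (k + s))) =
    N^-1 * N^-1 * \sum_(i in S) \sum_(j in S)
      xi j ^+ k * \sum_(0 <= s < d) xi i ^+ (d - s) * xi j ^+ s.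
  rewrite mulr_sumr.
  under [RHS]eq_bigr do rewrite mulr_sumr.
  under [RHS]eq_bigr do under eq_bigr do rewrite !mulr_sumr.
  under [RHS]eq_bigr do rewrite exchange_big.
  rewrite [RHS]exchange_big; apply: eq_bigr => s _.
  rewrite mulrACA mulr_suml mulr_sumr; apply: eq_bigr => i _.
  rewrite mulr_sumr mulr_sumr; apply: eq_bigr => j _.
  by rewrite exprD (mulrCA (xi i ^+ _)).
under eq_bigr => i Si.
  rewrite (bigD1 i) //= roots_orthogonal eqxx mul1r big1 => [|j /andP[_ ji]].
    rewrite addr0; over.
  by rewrite roots_orthogonal eq_sym (negbTE ji) mul0r mulr0.
by rewrite -mulr_suml -(mulrA N^-1 N^-1) (mulrC _ d%:R) 2!(mulrCA _ d%:R) mulKf.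
Qed.

End RootMeans.

(** * Nonvanishing of the constants in the base field *)

Section BaseField.
Context (R : realType).

Definition constk_morphism : {rmorphism R[i] -> kfield R} :=
  @tofrac {poly {poly R[i]}} \o (polyC \o polyC).

Lemma sqrtq_neq0 : sqrtq R != 0.
Proof. by rewrite tofrac_eq0 polyC_eq0 polyX_eq0. Qed.

Lemma zk_neq0 : zk R != 0.
Proof. by rewrite tofrac_eq0 polyX_eq0. Qed.

(** The numerator is a monic polynomial of degree one in [z]. *)
Lemma lambdaS_neq0 (d : nat) (S : {set 'I_d}) : lambdaS R S != 0.
Proof.
have ES : Ecst R S = constk_morphism #|S|%:R^-1 by rewrite fmorphV rmorph_nat.
rewrite /lambdaS; apply: mulf_neq0; last first.
  rewrite invr_eq0; apply: mulf_neq0 zk_neq0.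
  exact: (expf_neq0 2 sqrtq_neq0).
(* Here ['X] is the inner variable, the square root of [q]. *)
pose c : {poly R[i]} := (1 - 'X ^+ 2) * (#|S|%:R^-1)%:P.
have -> : zk R + (1 - qk R) * Ecst R S = tofrac ('X + c%:P).
  rewrite ES /c.
  rewrite rmorphD; congr (_ + _).
  rewrite polyCM rmorphM; congr (_ * _).
  by rewrite polyCB rmorphB polyC1 rmorph1 polyC_exp rmorphXn.
by rewrite tofrac_eq0 -[c]opprK polyCN polyXsubC_eq0.
Qed.

End BaseField.

(** * Application to the Juyumaya trace *)

Section Specialization.
Context (R : realType) (d : nat) (xi : 'I_d -> R[i]) (S : {set 'I_d}).
Context (tr : forall n, Ytilde d (qk R) n -> kfield R).
Context (kS : fieldExtType (kfield R)) (sl : kS).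
Context (trS : forall n, Ytilde d (qS kS) n -> kS).
Hypothesis d_gt0 : (0 < d)%N.
Hypothesis xi_inj : injective xi.
Hypothesis xi_order : forall i, xi i ^+ d = 1.
Hypothesis S_neq0 : S != finset.set0.
Hypothesis tr_JL : is_JL_trace S xi (@tr).
Hypothesis sl_sqr : sl ^+ 2 = (lambdaS R S)%:A.
Hypothesis trS_lin : forall n, scalar (@trS n).
Hypothesis trS_base : forall n (x : Ytilde d (qk R) n),
  @trS n (Ytilde_base_change kS x) = (@tr n x)%:A.

Let sigma : {rmorphism kfield R -> kS} := in_alg kS.
Let Y := YH_concrete_chain d 1 (qk R - 1) (qk R - 1).
Let Yt := YH_concrete_chain d 1 (qS kS - 1) (qS kS - 1).
Let Yg := YH_concrete_chain d ((sqrtqS kS * sl) ^+ 2) 0 ((qS kS - 1) * sl).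
Let cst b : kS := sigma (constk_morphism R (root_mean S xi b)).

Lemma JL_chain_trace :
  @chain_trace _ _ _ _ _ Y (zk R) (fun b => constk (root_mean S xi b)) (@tr).
Proof.
split.
- exact: (JL_linear tr_JL).
- exact: (JL_trace tr_JL).
- exact: (JL_braid tr_JL).
- exact: (JL_frame tr_JL).
Qed.

Let bc n : {rmorphism Y n -> Yt n} := @Ytilde_base_change _ kS d (qk R) n.

Lemma JL_extended_trace : @chain_trace _ _ _ _ _ Yt (sigma (zk R)) cst (@trS).
Proof.
apply: (@trace_extension _ _ _ _ _ _ _ _ _ Y Yt sigma bc _ _ _ _ _ _ _ JL_chain_trace).
- by move=> n x u; exact: base_changeZ.
- by move=> n i; exact: base_change_braid.
- by move=> n j; exact: base_change_frame.
- exact: trS_lin.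
- exact: trS_base.
Qed.

Let sqrtqS_neq0 : sqrtqS kS != 0.
Proof. by rewrite (fmorph_eq0 sigma) sqrtq_neq0. Qed.

Let zS_neq0 : sigma (zk R) != 0.
Proof. by rewrite fmorph_eq0 zk_neq0. Qed.

Let qS_sqr : qS kS = sqrtqS kS ^+ 2.
Proof. exact: (rmorphXn sigma). Qed.

Let sl_neq0 : sl != 0.
Proof.
have : sl ^+ 2 != 0 by rewrite sl_sqr (fmorph_eq0 sigma) lambdaS_neq0.
by rewrite expf_eq0.
Qed.

Let E : kS := sigma (Ecst R S).

Let sl_sqrE : sl ^+ 2 = (sigma (zk R) + (1 - qS kS) * E) / (qS kS * sigma (zk R)).
Proof.
transitivity (sigma (lambdaS R S)); first exact: sl_sqr.
rewrite -[qS kS]/(sigma (qk R)) /E.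
rewrite /lambdaS; move: (zk R) (qk R) (Ecst R S) => z q e.
by rewrite (rmorphM sigma) fmorphV (rmorphD sigma) !(rmorphM sigma) (rmorphB sigma)
  (rmorph1 sigma).
Qed.

Let d_neq0 : d%:R != 0 :> kS.
Proof.
rewrite -(rmorph_nat sigma) fmorph_eq0 -(rmorph_nat (constk_morphism R)).
by rewrite fmorph_eq0 pnatr_eq0 -lt0n.
Qed.

Let cst_period k : cst (k + d) = cst k.
Proof. by rewrite /cst root_mean_period. Qed.

Let cst_conv k :
  d%:R^-1 * \sum_(0 <= s < d) cst (d - s) * cst (k + s) = E * cst k.
Proof.
(* The identity for moments holds over the complex numbers and is mapped to [kS]. *)
pose mu : {rmorphism R[i] -> kS} := sigma \o constk_morphism R.
have -> : E = #|S|%:R^-1 by rewrite /E fmorphV rmorph_nat.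
rewrite /cst -/(mu _).
move: (root_mean S xi) (root_mean_conv d_gt0 xi_inj xi_order k S_neq0) => m.
move/(congr1 mu); rewrite !(rmorphM mu) !fmorphV !(rmorph_nat mu) rmorph_sum.
by under eq_bigr do rewrite (rmorphM mu).
Qed.

Let phi n : {rmorphism Yg n -> Yt n} := twist_morphism d n sl qS_sqr.

Let phiZ n : scalable (phi n). Proof. exact: twist_mapZ. Qed.
Let phi_braid n (i : 'I_n.-1) :
  phi n (chain_braid Yg i) = sl *: (((sqrtqS kS)%:A + (1 - sqrtqS kS) *:
    frame_idem d (chain_frame Yt (lower i)) (chain_frame Yt (upper i)))
    * chain_braid Yt i).
Proof. exact: twist_map_braid. Qed.
Let phi_frame n (j : 'I_n) : phi n (chain_frame Yg j) = chain_frame Yt j.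
Proof. exact: twist_map_frame. Qed.

Lemma rho_tilde_markov : is_markov_trace (rho_tilde (sl := sl) (@trS)).
Proof.
split.
- by move=> n; exact: (chain_rho_linear phiZ JL_extended_trace).
- by move=> n; exact: (chain_rho_cyclic phi JL_extended_trace).
move=> n x; split.
  exact: (chain_rho_braid phiZ phi_braid phi_frame sl_neq0 JL_extended_trace
    d_neq0 zS_neq0).
exact: (chain_rho_braidV phiZ phi_braid phi_frame sqrtqS_neq0 sl_neq0 qS_sqr
  JL_extended_trace d_neq0 cst_period cst_conv zS_neq0 sl_sqrE).
Qed.

Lemma identification_delta n (b : framed_braid_group d n) :
  identification (delta_gamma sl (sqrtqS kS)^-1 b) = delta_tilde sl b.
Proof.
exact: (identification_gamma phiZ phi_braid phi_frame sqrtqS_neq0 sl_neq0 b d_gt0).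
Qed.

End Specialization.

Theorem proposition6p12 (R : realType) (d : nat) (xi : 'I_d -> R[i])
    (S : {set 'I_d})
    (tr : forall n, Ytilde d (qk R) n -> kfield R)
    (kS : fieldExtType (kfield R)) (sl : kS)
    (trS : forall n, Ytilde d (qS kS) n -> kS)
    (beta : framed_link R d -> framed_braid d) :
  (0 < d)%N ->
  injective xi -> (forall a, xi a ^+ d = 1) ->
  S != finset.set0 ->
  is_JL_trace S xi tr ->
  sl ^+ 2 = (lambdaS R S)%:A -> <<1; sl>>%VS = {:kS}%VS ->
  (forall n, scalar (trS n)) ->
  (forall n (x : Ytilde d (qk R) n),
     trS n (Ytilde_base_change kS x) = (tr n x)%:A) ->
  is_braid_choice beta ->
  is_markov_trace (rho_tilde (sl := sl) trS) /\
  (forall K : framed_link R d,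
     FDelta sl trS beta K =
     FGamma (sqrtqS kS)^-1 (rho_tilde (sl := sl) trS) beta K).
Proof.
move=> d_gt0 xi_inj xi_order S_neq0 tr_JL sl_sqr _ trS_lin trS_base _; split.
  exact: (rho_tilde_markov d_gt0 xi_inj xi_order S_neq0 tr_JL sl_sqr).
move=> K; rewrite /FDelta /FGamma; case: (beta K) => n b.
(* On [n.+1] strands both invariants carry the factor [DS ^+ n], so only the images of the braid
   have to agree. *)
by rewrite /rho_tilde (identification_delta d_gt0 sl_sqr).
Qed.
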